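(* Let $\mu\in(0,+\infty)$ and let $f:[0,+\infty)\to\mathbb{R}$ be a $C^1$ function satisfying $$f(0)=f(1)=0,\quad f'(1)<0,\quad f(u)<0\ \text{ for } u>1.$$ Assume that $(c^*,q_{c^*})$, with $c^*\in\mathbb{R}$ and $q_{c^*}\in C^2([0,+\infty))$, is a solution $(c,q)$ of $$q''-cq'+f(q)=0\ \text{in}\ (0,+\infty),\quad q(z)>0\ \text{in}\ (0,+\infty),\quad q(0)=0,\quad q(+\infty)=1,\quad q'(0)=\frac{c}{\mu}.$$ Let $(u(t,x),h(t))$ be a bounded transition semi-wave connecting $1$ and $0$ of $$\begin{cases}u_t=u_{xx}+f(u), & t\in\mathbb{R},\ x<h(t),\\ u(t,h(t))=0, & t\in\mathbb{R},\\ h'(t)=-\mu u_x(t,h(t)), & t\in\mathbb{R}.\end{cases}$$ Then $u(t,x)=q_{c^*}(h(t)-x)$ for all $t\in\mathbb{R}$, $x\le h(t)$, and $h(t)=c^*t+h(0)$ for all $t\in\mathbb{R}$.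
   Context: For a continuous $h$ on $\mathbb{R}$ put $\Omega_h=\{(t,x): t\in\mathbb{R},\ x<h(t)\}$. An entire solution of the free boundary problem is a pair $(u,h)$ of functions satisfying it classically for all $t\in\mathbb{R}$; it is called positive (resp. bounded) if $u$ is positive (resp. bounded) in $\Omega_h$. A transition semi-wave connecting $1$ and $0$ is a positive entire solution $(u,h)$ such that $\lim_{x\to-\infty}|u(t,x+h(t))-1|=0$ uniformly in $t\in\mathbb{R}$. *)

(* Defs.v *)
From Stdlib Require Import Reals.
From Coquelicot Require Import Coquelicot.
Open Scope R_scope.

(* Functions on [0,+oo) are represented by total functions R -> R, of which only
   the values on [0,+oo) are used.  [D_in g dg nonneg z] is differentiability
   relative to [0,+oo), hence one-sided at z = 0. *)
Definition nonneg (z : R) : Prop := 0 <= z.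

Definition C1_nonneg (g dg : R -> R) : Prop :=
  (forall z, 0 <= z -> D_in g dg nonneg z) /\ continuous_on nonneg dg.

Definition semi_wave_profile (f : R -> R) (mu c : R) (q : R -> R) : Prop :=
  exists dq ddq : R -> R,
    C1_nonneg q dq /\
    C1_nonneg dq ddq /\
    (forall z, 0 < z -> ddq z - c * dq z + f (q z) = 0) /\
    (forall z, 0 < z -> 0 < q z) /\
    q 0 = 0 /\
    is_lim q p_infty 1 /\
    dq 0 = c / mu.

Definition Omega (h : R -> R) (p : R * R) : Prop := snd p < h (fst p).

Definition Omega_closed (h : R -> R) (p : R * R) : Prop := snd p <= h (fst p).

Definition uncurry2 (v : R -> R -> R) (p : R * R) : R := v (fst p) (snd p).

(* The values of u outside the closure of Omega h are irrelevant.  Classical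
   regularity for the Stefan problem: h is C^1, u_t and u_xx exist and are
   continuous in Omega h, and u, u_x are continuous up to the free boundary,
   where u_x is the left derivative. *)
Definition entire_solution (f : R -> R) (mu : R) (u : R -> R -> R) (h : R -> R)
    : Prop :=
  exists (ut ux uxx : R -> R -> R) (dh : R -> R),
    (forall t, is_derive h t (dh t)) /\
    (forall t, continuous dh t) /\
    (forall t x, x < h t -> is_derive (fun s => u s x) t (ut t x)) /\
    (forall t x, x <= h t -> D_in (u t) (ux t) (fun y => y <= h t) x) /\
    (forall t x, x < h t -> is_derive (ux t) x (uxx t x)) /\
    continuous_on (Omega_closed h) (uncurry2 u) /\
    continuous_on (Omega_closed h) (uncurry2 ux) /\
    continuous_on (Omega h) (uncurry2 ut) /\
    continuous_on (Omega h) (uncurry2 uxx) /\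
    (forall t x, x < h t -> ut t x = uxx t x + f (u t x)) /\
    (forall t, u t (h t) = 0) /\
    (forall t, dh t = - mu * ux t (h t)).

Definition positive_in (h : R -> R) (u : R -> R -> R) : Prop :=
  forall t x, x < h t -> 0 < u t x.

Definition bounded_in (h : R -> R) (u : R -> R -> R) : Prop :=
  exists M, forall t x, x < h t -> Rabs (u t x) <= M.

Definition transition_semi_wave (f : R -> R) (mu : R) (u : R -> R -> R)
    (h : R -> R) : Prop :=
  entire_solution f mu u h /\
  positive_in h u /\
  (forall eps, 0 < eps ->
     exists A, forall t x, x < A -> Rabs (u t (x + h t) - 1) < eps).

(* Main.v *)
Require Import Defs.
From Stdlib Require Import Reals Lra Classical ClassicalEpsilon.
From Coquelicot Require Import Coquelicot.
Open Scope R_scope.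

(** The profile Q is strictly increasing, and the state 1 behind the front is
    stable because f'(1) < 0. Hence (lemma [semi_wave_stability]) a
    near-ordering between u and a shifted semi-wave Q(c t + xi - x) persists
    forever at the price of a small additional shift. As u tends to 1 uniformly
    at a bounded distance behind its front, such orderings hold at every
    starting time; letting the starting time tend to minus infinity traps u
    between two shifted semi-waves (lemma [solution_between_shifts]).

    Let Q(c t + xp - x) be the lowest shifted semi-wave above u and
    Q(c t + xm - x) the highest one below it. If xm < xp, then at arbitrarily
    early times u must come close to the lower one at a bounded distance from
    the front: otherwise it would lie above a slightly larger shift there, and
    also further behind, up to a negligible relative error as Q' tends to 0, and
    stability would improve xm. Such a point is a gap below the upper semi-wave.
    It spreads within a time independent of the point to a gap, of a size
    independent of the point, over a long interval reaching beyond the front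
    (lemma [gap_spreads]). Stability then improves xp, a contradiction. So
    xm = xp, and u is a semi-wave.

    No limits of translated solutions are taken. Compactness is replaced by
    explicit barriers, which all go through one comparison lemma
    ([barrier_comparison]), and by a one-sided Lipschitz bound in x
    ([solution_one_sided_lipschitz]) that widens a gap at a point to an
    interval of definite length. *)

(** * Calculus at extremal points *)

Lemma continuous_R_eps : forall (g : R -> R) (x : R),
  continuous g x <->
  (forall eps, 0 < eps -> exists d, 0 < d /\
     forall y, Rabs (y - x) < d -> Rabs (g y - g x) < eps).
Proof.
  intros g x; split.
  - intros H eps He.
    destruct (proj1 (filterlim_locally _ _) H (mkposreal eps He)) as [d Hd].
    exists (pos d); split; [apply cond_pos | intros y Hy; exact (Hd y Hy)].
  - intros H; apply filterlim_locally; intros [eps He].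
    destruct (H eps He) as [d [Hd H1]].
    exists (mkposreal d Hd); intros y Hy; exact (H1 y Hy).
Qed.

Lemma is_derive_R_eps : forall (g : R -> R) (x l : R),
  is_derive g x l <->
  (forall eps, 0 < eps -> exists d, 0 < d /\
     forall y, y <> x -> Rabs (y - x) < d ->
       Rabs ((g y - g x) / (y - x) - l) < eps).
Proof.
  intros g x l; rewrite is_derive_Reals; split.
  - intros H eps He; destruct (H eps He) as [d Hd].
    exists (pos d); split; [apply cond_pos |].
    intros y Hy Hyd; specialize (Hd (y - x)).
    replace (x + (y - x)) with y in Hd by ring.
    apply Hd; [lra | exact Hyd].
  - intros H eps He; destruct (H eps He) as [d [Hd H1]].
    exists (mkposreal d Hd); simpl; intros k Hk Hkd.
    specialize (H1 (x + k)).
    replace (x + k - x) with k in H1 by ring.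
    apply H1; [lra | exact Hkd].
Qed.

Lemma continuous_pos_near : forall (g : R -> R) (x : R),
  continuous g x -> 0 < g x ->
  exists d, 0 < d /\ forall y, Rabs (y - x) < d -> 0 < g y.
Proof.
  intros g x Hc Hp.
  destruct (proj1 (continuous_R_eps g x) Hc (g x) Hp) as [d [Hd H]].
  exists d; split; [exact Hd |]; intros y Hy.
  specialize (H y Hy); apply Rabs_def2 in H; lra.
Qed.

Lemma continuous_nonneg_left : forall (g : R -> R) (x d : R),
  continuous g x -> 0 < d -> (forall y, x - d < y < x -> 0 <= g y) -> 0 <= g x.
Proof.
  intros g x d Hc Hd H.
  destruct (Rle_lt_dec 0 (g x)) as [|Hn]; [assumption | exfalso].
  destruct (proj1 (continuous_R_eps g x) Hc (- g x)) as [e [He H1]]; [lra |].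
  set (k := Rmin d e / 2).
  assert (0 < k /\ k < d /\ k < e) as [Hk [Hkd Hke]].
  { unfold k; generalize (Rmin_l d e) (Rmin_r d e) (Rmin_glb_lt _ _ _ Hd He); lra. }
  specialize (H (x - k)); specialize (H1 (x - k)).
  assert (Rabs (x - k - x) < e) by (rewrite Rabs_left; lra).
  specialize (H1 H0); apply Rabs_def2 in H1.
  assert (0 <= g (x - k)) by (apply H; lra). lra.
Qed.

(** Weak enough to hold both for two-sided derivatives and, at the free
    boundary, for derivatives relative to a half line. *)
Definition left_derivative (g : R -> R) (x l : R) : Prop :=
  forall eps, 0 < eps -> exists d, 0 < d /\
    forall y, x - d < y < x -> Rabs ((g y - g x) / (y - x) - l) < eps.

Lemma is_derive_left : forall g x l, is_derive g x l -> left_derivative g x l.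
Proof.
  intros g x l H eps He.
  destruct (proj1 (is_derive_R_eps g x l) H eps He) as [d [Hd H1]].
  exists d; split; [exact Hd |]; intros y Hy.
  apply H1; [lra |]; rewrite Rabs_left; lra.
Qed.

Lemma left_derivative_nonpos : forall g x l d,
  left_derivative g x l -> 0 < d ->
  (forall y, x - d < y < x -> g x <= g y) -> l <= 0.
Proof.
  intros g x l d H Hd Hm.
  destruct (Rle_lt_dec l 0) as [|Hl]; [assumption | exfalso].
  destruct (H l Hl) as [e [He H1]].
  set (k := Rmin d e / 2).
  assert (0 < k /\ k < d /\ k < e) as [Hk [Hkd Hke]].
  { unfold k; generalize (Rmin_l d e) (Rmin_r d e) (Rmin_glb_lt _ _ _ Hd He); lra. }
  specialize (H1 (x - k)); specialize (Hm (x - k)).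
  assert (Hq : (g (x - k) - g x) / (x - k - x) <= 0).
  { replace ((g (x - k) - g x) / (x - k - x))
      with (- ((g (x - k) - g x) * / k)) by (field; lra).
    assert (0 <= (g (x - k) - g x) * / k).
    { apply Rmult_le_pos; [assert (g x <= g (x - k)) by (apply Hm; lra); lra |].
      left; apply Rinv_0_lt_compat; lra. }
    lra. }
  assert (Hb : x - e < x - k < x) by lra.
  specialize (H1 Hb); apply Rabs_def2 in H1; lra.
Qed.

Lemma is_derive_opp_arg : forall g x l,
  is_derive g x l -> is_derive (fun y => g (- y)) (- x) (- l).
Proof.
  intros g x l H.
  assert (H' : is_derive g (- - x) l) by (rewrite Ropp_involutive; exact H).
  replace (- l) with (scal (-1) l) by (unfold scal; simpl; unfold mult; simpl; ring).
  apply (is_derive_comp g (fun y => - y) (- x) l (-1) H').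
  auto_derive; [trivial | ring].
Qed.

Lemma is_derive_local_min : forall g x l d,
  is_derive g x l -> 0 < d ->
  (forall y, Rabs (y - x) < d -> g x <= g y) -> l = 0.
Proof.
  intros g x l d H Hd Hm.
  apply Rle_antisym.
  - apply (left_derivative_nonpos g x l d); [apply is_derive_left, H | exact Hd |].
    intros y Hy; apply Hm; rewrite Rabs_left; lra.
  - assert (- l <= 0); [| lra].
    apply (left_derivative_nonpos (fun y => g (- y)) (- x) (- l) d);
      [apply is_derive_left, is_derive_opp_arg, H | exact Hd |].
    intros y Hy; rewrite Ropp_involutive; apply Hm; rewrite Rabs_right; lra.
Qed.

Lemma is_derive_continuous : forall (g : R -> R) (x l : R),
  is_derive g x l -> continuous g x.
Proof.
  intros g x l H; apply (ex_derive_continuous (K := R_AbsRing) (V := R_NormedModule)).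
  exists l; exact H.
Qed.

Lemma mean_value : forall (g dg : R -> R) (a b : R),
  a < b ->
  (forall x, a < x < b -> is_derive g x (dg x)) ->
  (forall x, a <= x <= b -> continuous g x) ->
  exists x, a < x < b /\ g b - g a = dg x * (b - a).
Proof.
  intros g dg a b Hab Hd Hc.
  assert (pr1 : forall x, a < x < b -> derivable_pt g x).
  { intros x Hx; exists (dg x); apply is_derive_Reals, Hd, Hx. }
  assert (pr2 : forall x, a < x < b -> derivable_pt id x).
  { intros x _; apply derivable_pt_id. }
  destruct (MVT g id a b pr1 pr2 Hab) as [x [Hx H]].
  - intros x Hx; apply continuity_pt_filterlim, Hc, Hx.
  - intros x _; apply derivable_continuous_pt, derivable_pt_id.
  - exists x; split; [exact Hx |].
    rewrite (derive_pt_eq_0 g x (dg x) (pr1 x Hx)) in H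
      by (apply is_derive_Reals, Hd, Hx).
    rewrite (derive_pt_eq_0 id x 1 (pr2 x Hx)) in H
      by apply derivable_pt_lim_id.
    unfold id in H; lra.
Qed.

Lemma nondecreasing_of_derivative : forall (g dg : R -> R) (a b : R),
  a <= b ->
  (forall x, a < x < b -> is_derive g x (dg x)) ->
  (forall x, a <= x <= b -> continuous g x) ->
  (forall x, a < x < b -> 0 <= dg x) -> g a <= g b.
Proof.
  intros g dg a b [Hab | ->] Hd Hc Hp; [| lra].
  destruct (mean_value g dg a b Hab Hd Hc) as [x [Hx H]].
  specialize (Hp x Hx); nra.
Qed.

Lemma second_derivative_local_min : forall g dg x l d,
  0 < d ->
  (forall y, Rabs (y - x) < d -> is_derive g y (dg y)) ->
  is_derive dg x l ->
  (forall y, Rabs (y - x) < d -> g x <= g y) -> 0 <= l.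
Proof.
  intros g dg x l d Hd Hg Hdg Hm.
  destruct (Rle_lt_dec 0 l) as [|Hl]; [assumption | exfalso].
  assert (H0 : dg x = 0).
  { apply (is_derive_local_min g x _ d); [apply Hg | |]; auto.
    rewrite Rminus_diag, Rabs_R0; exact Hd. }
  destruct (proj1 (is_derive_R_eps dg x l) Hdg (- l)) as [e [He H1]]; [lra |].
  set (k := Rmin d e / 2).
  assert (0 < k /\ k < d /\ k < e) as [Hk [Hkd Hke]].
  { unfold k; generalize (Rmin_l d e) (Rmin_r d e) (Rmin_glb_lt _ _ _ Hd He); lra. }
  destruct (mean_value g dg x (x + k)) as [z [Hz Hz']]; [lra | | |].
  - intros y Hy; apply Hg; rewrite Rabs_right; lra.
  - intros y Hy; apply (is_derive_continuous g y (dg y)), Hg; rewrite Rabs_right; lra.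
  - assert (g x <= g (x + k)) by (apply Hm; rewrite Rabs_right; lra).
    assert (Hdz : 0 <= dg z) by nra.
    specialize (H1 z); rewrite H0 in H1.
    assert (Hq : 0 <= (dg z - 0) / (z - x)).
    { apply Rmult_le_pos; [lra | left; apply Rinv_0_lt_compat; lra]. }
    assert (Rabs (z - x) < e) by (rewrite Rabs_right; lra).
    assert (Hzx : z <> x) by lra.
    specialize (H1 Hzx H2); apply Rabs_def2 in H1; lra.
Qed.

(** * Bounded closed sets have an earliest point *)

Definition is_cv (s : nat -> R) (l : R) : Prop := is_lim_seq s l.

Lemma is_cv_eps : forall s l,
  is_cv s l <->
  (forall eps, 0 < eps -> exists N, forall n, (N <= n)%nat -> Rabs (s n - l) < eps).
Proof.
  intros s l; unfold is_cv; rewrite is_lim_seq_Reals; unfold Un_cv, Rdist.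
  unfold ge; split; intros H eps He; apply H; lra.
Qed.

Lemma bounded_subsequence : forall (s : nat -> R) (m M : R),
  (forall n, m <= s n <= M) ->
  exists (phi : nat -> nat) (l : R),
    (forall n, (n <= phi n)%nat) /\ is_cv (fun n => s (phi n)) l.
Proof.
  intros s m M Hs.
  destruct (Bolzano_Weierstrass s (fun x => m <= x <= M) (compact_P3 m M) Hs)
    as [l Hl].
  assert (H : forall n, exists p, (n <= p)%nat /\ Rabs (s p - l) < / (INR n + 1)).
  { intros n.
    assert (Hn : 0 < / (INR n + 1)).
    { apply Rinv_0_lt_compat; generalize (pos_INR n); lra. }
    destruct (Hl (disc l (mkposreal _ Hn)) n) as [p [Hp Hp']].
    - exists (mkposreal _ Hn); intros x Hx; exact Hx.
    - exists p; split; [exact Hp | exact Hp']. }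
  exists (fun n => proj1_sig (constructive_indefinite_description _ (H n))), l.
  split.
  - intros n; destruct (constructive_indefinite_description _ (H n)) as [p Hp]; simpl; tauto.
  - apply is_cv_eps; intros eps He.
    destruct (archimed_cor1 eps He) as [N [HN HN0]].
    exists N; intros n Hn.
    destruct (constructive_indefinite_description _ (H n)) as [p Hp]; simpl; destruct Hp as [_ Hp].
    apply Rlt_trans with (1 := Hp), Rle_lt_trans with (2 := HN).
    apply Rinv_le_contravar; [apply lt_0_INR; exact HN0 |].
    apply le_INR in Hn; lra.
Qed.

Lemma is_cv_subsequence : forall s l (phi : nat -> nat),
  is_cv s l -> (forall n, (n <= phi n)%nat) -> is_cv (fun n => s (phi n)) l.
Proof.
  intros s l phi H Hphi; apply is_cv_eps; intros eps He.
  destruct (proj1 (is_cv_eps s l) H eps He) as [N HN].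
  exists N; intros n Hn; apply HN; apply Nat.le_trans with (1 := Hn), Hphi.
Qed.

Definition closed_seq (B : R -> R -> R -> Prop) : Prop :=
  forall tn xn yn t x y,
    (forall n, B (tn n) (xn n) (yn n)) ->
    is_cv tn t -> is_cv xn x -> is_cv yn y -> B t x y.

(** The engine of every comparison argument below: applied to the closed set
    where an inequality fails, it produces a first point of failure, before
    which the strict inequality holds everywhere. *)
Lemma earliest_point : forall (B : R -> R -> R -> Prop) (m M : R),
  (forall t x y, B t x y -> m <= t <= M /\ m <= x <= M /\ m <= y <= M) ->
  closed_seq B ->
  (exists t x y, B t x y) ->
  exists t x y, B t x y /\ forall t' x' y', B t' x' y' -> t <= t'.
Proof.
  intros B m M Hb Hc [t0 [x0 [y0 H0]]].
  destruct (completeness (fun r => exists x y, B (- r) x y)) as [r [Hr1 Hr2]].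
  - exists (- m); intros r [x [y H]]; apply Hb in H; lra.
  - exists (- t0), x0, y0; rewrite Ropp_involutive; exact H0.
  - assert (Hle : forall t x y, B t x y -> - r <= t).
    { intros t x y H; assert (- t <= r); [| lra].
      apply Hr1; exists x, y; rewrite Ropp_involutive; exact H. }
    assert (Hn : forall n : nat, exists p : R * R * R,
      B (fst (fst p)) (snd (fst p)) (snd p) /\ fst (fst p) < - r + / (INR n + 1)).
    { intros n; apply NNPP; intros Hn.
      assert (Hp : 0 < / (INR n + 1)).
      { apply Rinv_0_lt_compat; generalize (pos_INR n); lra. }
      assert (r <= r - / (INR n + 1)); [| lra].
      apply Hr2; intros t [x [y H]].
      destruct (Rle_lt_dec t (r - / (INR n + 1))) as [|Ht]; [assumption | exfalso].
      apply Hn; exists (- t, x, y); simpl; split; [exact H | lra]. }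
    set (p := fun n => proj1_sig (constructive_indefinite_description _ (Hn n))).
    assert (HB : forall n, B (fst (fst (p n))) (snd (fst (p n))) (snd (p n))).
    { intros n; unfold p.
      destruct (constructive_indefinite_description _ (Hn n)); simpl; tauto. }
    assert (Ht : is_cv (fun n => fst (fst (p n))) (- r)).
    { apply is_cv_eps; intros eps He.
      destruct (archimed_cor1 eps He) as [N [HN HN0]].
      exists N; intros n Hn'.
      assert (H1 := Hle _ _ _ (HB n)).
      assert (H2 : fst (fst (p n)) < - r + / (INR n + 1)).
      { unfold p; destruct (constructive_indefinite_description _ (Hn n)); simpl; tauto. }
      assert (/ (INR n + 1) <= / INR N).
      { apply Rinv_le_contravar; [apply lt_0_INR; exact HN0 |].
        apply le_INR in Hn'; lra. }
      rewrite Rabs_right; lra. }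
    destruct (bounded_subsequence (fun n => snd (fst (p n))) m M) as [f1 [x [Hf1 Hx]]].
    { intros n; apply (Hb _ _ _ (HB n)). }
    destruct (bounded_subsequence (fun n => snd (p (f1 n))) m M) as [f2 [y [Hf2 Hy]]].
    { intros n; apply (Hb _ _ _ (HB (f1 n))). }
    exists (- r), x, y; split; [| exact Hle].
    apply (Hc (fun n => fst (fst (p (f1 (f2 n))))) (fun n => snd (fst (p (f1 (f2 n)))))
              (fun n => snd (p (f1 (f2 n))))).
    + intros n; apply HB.
    + apply (is_cv_subsequence (fun n => fst (fst (p (f1 n))))); [| exact Hf2].
      apply (is_cv_subsequence _ _ f1 Ht Hf1).
    + apply (is_cv_subsequence (fun n => snd (fst (p (f1 n))))); [exact Hx | exact Hf2].
    + exact Hy.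
Qed.

(** [auto_derive] leaves the derivatives of abstract functions as [Derive]
    terms. *)
Ltac subst_derive H :=
  match type of H with
  | is_derive _ ?x ?l =>
      match goal with
      | |- context [Derive ?g x] =>
          replace (Derive g x) with l by (symmetry; apply is_derive_unique; exact H)
      end
  end.

(** * Continuously differentiable extensions *)

Lemma D_in_eps : forall (g dg : R -> R) (D : R -> Prop) (z : R),
  D_in g dg D z ->
  forall eps, 0 < eps -> exists d, 0 < d /\
    forall y, D y -> y <> z -> Rabs (y - z) < d ->
      Rabs ((g y - g z) / (y - z) - dg z) < eps.
Proof.
  intros g dg D z H eps He.
  destruct (H eps He) as [d [Hd H1]]; exists d; split; [exact Hd |].
  intros y Hy Hyz Hyd; apply (H1 y); split; [split; [exact Hy | auto] | exact Hyd].
Qed.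

Lemma D_in_interior : forall (g dg : R -> R) (D : R -> Prop) (z r : R),
  D_in g dg D z -> 0 < r -> (forall y, Rabs (y - z) < r -> D y) ->
  is_derive g z (dg z).
Proof.
  intros g dg D z r H Hr HD; apply is_derive_R_eps; intros eps He.
  destruct (D_in_eps g dg D z H eps He) as [d [Hd H1]].
  exists (Rmin d r); split; [apply Rmin_glb_lt; assumption |].
  intros y Hyz Hy.
  generalize (Rmin_l d r) (Rmin_r d r); intros.
  apply H1; [apply HD; lra | exact Hyz | lra].
Qed.

Lemma is_derive_ext_near : forall (g k : R -> R) (z l r : R),
  0 < r -> (forall y, Rabs (y - z) < r -> g y = k y) ->
  is_derive g z l -> is_derive k z l.
Proof.
  intros g k z l r Hr He H; apply (is_derive_ext_loc g); [| exact H].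
  exists (mkposreal r Hr); intros y Hy; apply He, Hy.
Qed.

(** Continuing linearly below 0 turns a one-sided C1 function on the half line
    into a C1 function on the line, so that two-sided calculus applies at 0. *)
Lemma C1_extension : forall g dg : R -> R,
  C1_nonneg g dg ->
  exists G dG : R -> R,
    (forall z, is_derive G z (dG z)) /\
    (forall z, continuous dG z) /\
    (forall z, 0 <= z -> G z = g z) /\
    (forall z, 0 <= z -> dG z = dg z) /\
    (forall z, z <= 0 -> dG z = dg 0).
Proof.
  intros g dg [Hd Hc].
  exists (fun z => if Rle_dec 0 z then g z else g 0 + dg 0 * z), (fun z => dg (Rmax 0 z)).
  split; [| split; [| split; [| split]]].
  - intros z; destruct (Rtotal_order z 0) as [Hz | [-> | Hz]].
    + rewrite Rmax_left by lra.
      apply (is_derive_ext_near (fun y => g 0 + dg 0 * y) _ z _ (- z)); [lra | |].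
      * intros y Hy; apply Rabs_def2 in Hy.
        destruct (Rle_dec 0 y); [lra | reflexivity].
      * auto_derive; [trivial | ring].
    + rewrite Rmax_left by lra.
      apply is_derive_R_eps; intros eps He.
      destruct (D_in_eps _ _ _ _ (Hd 0 (Rle_refl 0)) eps He) as [d [Hd0 H1]].
      exists d; split; [exact Hd0 |]; intros y Hy Hyd.
      destruct (Rle_dec 0 0) as [_ | n]; [| lra].
      destruct (Rle_dec 0 y) as [Hy0 | Hy0].
      * apply H1; [exact Hy0 | exact Hy | exact Hyd].
      * replace ((g 0 + dg 0 * y - g 0) / (y - 0) - dg 0) with 0 by (field; lra).
        rewrite Rabs_R0; exact He.
    + rewrite Rmax_right by lra.
      apply (is_derive_ext_near g _ z _ z); [lra | |].
      * intros y Hy; apply Rabs_def2 in Hy.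
        destruct (Rle_dec 0 y); [reflexivity | lra].
      * apply (D_in_interior g dg Defs.nonneg z z); [apply Hd; lra | lra |].
        intros y Hy; apply Rabs_def2 in Hy; unfold Defs.nonneg; lra.
  - intros z; apply continuous_R_eps; intros eps He.
    assert (Hm : Defs.nonneg (Rmax 0 z)) by apply Rmax_l.
    destruct (proj1 (filterlim_locally _ _) (Hc _ Hm) (mkposreal eps He)) as [d H1].
    exists (pos d); split; [apply cond_pos |]; intros y Hy.
    apply (H1 (Rmax 0 y)); [| apply Rmax_l].
    apply Rle_lt_trans with (2 := Hy).
    unfold abs, minus, plus, opp; simpl.
    unfold Rmax; destruct (Rle_dec 0 y), (Rle_dec 0 z); unfold Rabs;
      repeat destruct Rcase_abs; lra.
  - intros z Hz; destruct (Rle_dec 0 z); [reflexivity | lra].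
  - intros z Hz; rewrite Rmax_right by exact Hz; reflexivity.
  - intros z Hz; rewrite Rmax_left by exact Hz; reflexivity.
Qed.

Lemma continuous_bounded : forall (g : R -> R) (a b : R),
  a <= b -> (forall x, a <= x <= b -> continuous g x) ->
  exists M, 0 < M /\ forall x, a <= x <= b -> Rabs (g x) <= M.
Proof.
  intros g a b Hab Hc.
  destruct (continuity_ab_maj (fun x => Rabs (g x)) a b Hab) as [x0 [H0 _]].
  - intros x Hx; apply continuity_pt_filterlim.
    apply (continuous_comp g Rabs x (Hc x Hx)), continuous_Rabs.
  - exists (Rabs (g x0) + 1); split; [generalize (Rabs_pos (g x0)); lra |].
    intros x Hx; specialize (H0 x Hx); lra.
Qed.

Lemma C1_lipschitz : forall (g dg : R -> R) (a b : R),
  a <= b ->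
  (forall x, is_derive g x (dg x)) -> (forall x, continuous dg x) ->
  exists K, 0 < K /\
    forall x y, a <= x <= b -> a <= y <= b -> Rabs (g x - g y) <= K * Rabs (x - y).
Proof.
  intros g dg a b Hab Hd Hc.
  destruct (continuous_bounded dg a b Hab) as [K [HK H]]; [intros; apply Hc |].
  exists K; split; [exact HK |].
  assert (Hlt : forall x y, a <= x <= b -> a <= y <= b -> x < y ->
            Rabs (g x - g y) <= K * Rabs (x - y)).
  { intros x y Hx Hy Hxy.
    destruct (mean_value g dg x y Hxy) as [z [Hz Hz']].
    - intros; apply Hd.
    - intros z _; apply (is_derive_continuous _ _ _ (Hd z)).
    - replace (g x - g y) with (dg z * (x - y)) by lra.
      rewrite Rabs_mult; apply Rmult_le_compat_r; [apply Rabs_pos |].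
      apply H; lra. }
  intros x y Hx Hy; destruct (Rtotal_order x y) as [Hxy | [-> | Hxy]].
  - apply Hlt; assumption.
  - rewrite !Rminus_diag, Rabs_R0; lra.
  - rewrite Rabs_minus_sym, (Rabs_minus_sym x y); apply Hlt; assumption.
Qed.

(** * Monotonicity of the semi-wave profile *)

Record reaction (f df : R -> R) : Prop := {
  re_derive : forall v, is_derive f v (df v);
  re_cont : forall v, continuous df v;
  re_zero : f 0 = 0;
  re_one : f 1 = 0;
  re_stable : df 1 < 0;
  re_above : forall v, 1 < v -> f v < 0
}.

Record profile_ode (f : R -> R) (c : R) (Q dQ ddQ : R -> R) : Prop := {
  po_Q : forall z, is_derive Q z (dQ z);
  po_dQ_cont : forall z, continuous dQ z;
  po_dQ : forall z, 0 < z -> is_derive dQ z (ddQ z);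
  po_eq : forall z, 0 < z -> ddQ z = c * dQ z - f (Q z)
}.

Lemma po_Q_cont : forall f c Q dQ ddQ, profile_ode f c Q dQ ddQ ->
  forall z, continuous Q z.
Proof.
  intros f c Q dQ ddQ H z; apply (is_derive_continuous _ _ _ (po_Q _ _ _ _ _ H z)).
Qed.

(** G exp(C z) and G exp(-C z) are monotone, so a zero of G propagates in both
    directions. *)
Lemma gronwall_vanish : forall (G dG : R -> R) (C a b z0 : R),
  a <= z0 <= b ->
  (forall z, a < z < b -> is_derive G z (dG z)) ->
  (forall z, a <= z <= b -> continuous G z) ->
  (forall z, a < z < b -> Rabs (dG z) <= C * G z) ->
  (forall z, 0 <= G z) ->
  G z0 = 0 -> forall z, a <= z <= b -> G z = 0.
Proof.
  intros G dG C a b z0 Hz0 Hd Hc HC Hp H0 z Hz.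
  apply Rle_antisym; [| apply Hp].
  assert (Hce : forall k y, a <= y <= b -> continuous (fun x => exp (k * x) * G x) y).
  { intros k y Hy; apply (continuous_mult (fun x => exp (k * x)) G); [| apply Hc; lra].
    apply (is_derive_continuous _ _ (k * exp (k * y))); auto_derive; [trivial | ring]. }
  assert (Hde : forall k y, a < y < b ->
            is_derive (fun x => exp (k * x) * G x) y (exp (k * y) * (dG y + k * G y))).
  { intros k y Hy; auto_derive; [exists (dG y); apply Hd, Hy |].
    subst_derive (Hd y Hy); ring. }
  destruct (Rle_lt_dec z0 z) as [Hle | Hlt].
  - assert (H : - (exp (- C * z0) * G z0) <= - (exp (- C * z) * G z)).
    { apply (nondecreasing_of_derivative (fun x => - (exp (- C * x) * G x))
               (fun x => - (exp (- C * x) * (dG x + - C * G x)))); [exact Hle | | |].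
      - intros y Hy; apply (is_derive_opp (fun x => exp (- C * x) * G x)), Hde; lra.
      - intros y Hy; apply (continuous_opp (fun x => exp (- C * x) * G x)), Hce; lra.
      - intros y Hy; assert (Hy' : a < y < b) by lra.
        specialize (HC y Hy'); generalize (Rle_abs (dG y)) (exp_pos (- C * y)); intros.
        nra. }
    rewrite H0 in H; generalize (exp_pos (- C * z)); nra.
  - assert (H : exp (C * z) * G z <= exp (C * z0) * G z0).
    { apply (nondecreasing_of_derivative (fun x => exp (C * x) * G x)
               (fun x => exp (C * x) * (dG x + C * G x))); [lra | | |].
      - intros y Hy; apply Hde; lra.
      - intros y Hy; apply Hce; lra.
      - intros y Hy; assert (Hy' : a < y < b) by lra.
        specialize (HC y Hy'); generalize (Rle_abs (- dG y)) (exp_pos (C * y)).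
        rewrite Rabs_Ropp; intros; nra. }
    rewrite H0 in H; generalize (exp_pos (C * z)); nra.
Qed.

(** Uniqueness for the profile equation at an equilibrium. *)
Lemma profile_rest_point : forall f df c Q dQ ddQ z0,
  reaction f df -> profile_ode f c Q dQ ddQ ->
  0 <= z0 -> dQ z0 = 0 -> f (Q z0) = 0 -> forall z, 0 <= z -> Q z = Q z0.
Proof.
  intros f df c Q dQ ddQ z0 Hf HQ Hz0 Hd0 Hf0 z Hz.
  set (a := Q z0); set (b := Rmax z z0).
  assert (Hb : z <= b /\ z0 <= b) by (split; [apply Rmax_l | apply Rmax_r]).
  destruct (continuous_bounded Q 0 b) as [M [HM HMb]];
    [lra | intros; apply (po_Q_cont _ _ _ _ _ HQ) |].
  destruct (C1_lipschitz f df (- M) M) as [K [HK HKb]];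
    [lra | apply Hf | apply Hf |].
  set (G := fun x => dQ x * dQ x + (Q x - a) * (Q x - a)).
  assert (HG : G z = 0).
  { apply (gronwall_vanish G (fun x => 2 * dQ x * (ddQ x + (Q x - a)))
             (2 * Rabs c + K + 1) 0 b z0); try lra.
    - intros x Hx; unfold G; auto_derive.
      + repeat split; try (exists (dQ x); apply HQ); exists (ddQ x); apply HQ; lra.
      + assert (Hx0 : 0 < x) by lra; assert (H1 := po_Q _ _ _ _ _ HQ x); assert (H2 := po_dQ _ _ _ _ _ HQ x Hx0).
        subst_derive H1; subst_derive H2.
        ring.
    - intros x Hx; unfold G.
      assert (continuous (fun y => Q y - a) x).
      { apply (continuous_minus Q (fun _ => a));
          [apply (po_Q_cont _ _ _ _ _ HQ) | apply continuous_const]. }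
      apply (continuous_plus (fun y => dQ y * dQ y) (fun y => (Q y - a) * (Q y - a)));
        apply (continuous_mult (K := R_AbsRing)); try apply HQ; assumption.
    - intros x Hx; rewrite (po_eq _ _ _ _ _ HQ) by lra.
      assert (Hfx : Rabs (f (Q x)) <= K * Rabs (Q x - a)).
      { replace (f (Q x)) with (f (Q x) - f a) by (unfold a; lra).
        apply HKb; apply Rabs_le_between; apply HMb; lra. }
      set (q := Rabs (Q x - a)) in *; set (p := Rabs (dQ x)).
      assert (Hq : (Q x - a) * (Q x - a) = q * q)
        by (unfold q; rewrite <- Rabs_mult; symmetry; apply Rabs_pos_eq, Rle_0_sqr).
      assert (Hp : dQ x * dQ x = p * p)
        by (unfold p; rewrite <- Rabs_mult; symmetry; apply Rabs_pos_eq, Rle_0_sqr).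
      unfold G; rewrite Hq, Hp, !Rabs_mult, (Rabs_right 2) by lra; fold p.
      assert (Rabs (c * dQ x - f (Q x) + (Q x - a)) <= Rabs c * p + K * q + q).
      { apply Rle_trans with (1 := Rabs_triang _ _).
        apply Rplus_le_compat; [| unfold q; lra].
        apply Rle_trans with (1 := Rabs_triang _ _).
        rewrite Rabs_Ropp, Rabs_mult; apply Rplus_le_compat; [unfold p; lra | exact Hfx]. }
      assert (0 <= p) by apply Rabs_pos. assert (0 <= q) by apply Rabs_pos.
      assert (0 <= Rabs c) by apply Rabs_pos.
      apply Rle_trans with (2 * p * (Rabs c * p + K * q + q)); [apply Rmult_le_compat_l; lra |].
      assert (0 <= (K + 1) * ((p - q) * (p - q))) by (apply Rmult_le_pos; [lra | apply Rle_0_sqr]).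
      assert (0 <= Rabs c * (q * q)) by (apply Rmult_le_pos; [assumption | apply Rle_0_sqr]). nra.
    - intros x; unfold G; apply Rplus_le_le_0_compat; apply Rle_0_sqr.
    - unfold G, a; rewrite Hd0; ring. }
  unfold G in HG; apply Rplus_eq_R0 in HG; try apply Rle_0_sqr.
  destruct HG as [_ HG]; apply Rsqr_0_uniq in HG; lra.
Qed.

Lemma is_derive_pos_sides : forall (g : R -> R) (x l : R),
  is_derive g x l -> 0 < l ->
  exists d, 0 < d /\
    (forall y, x < y < x + d -> g x < g y) /\
    (forall y, x - d < y < x -> g y < g x).
Proof.
  intros g x l H Hl.
  destruct (proj1 (is_derive_R_eps g x l) H l Hl) as [d [Hd H1]].
  exists d; split; [exact Hd |].
  assert (Hq : forall y, y <> x -> Rabs (y - x) < d -> 0 < (g y - g x) / (y - x)).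
  { intros y Hy Hyd; specialize (H1 y Hy Hyd); apply Rabs_def2 in H1; lra. }
  assert (Hm : forall y, y <> x -> g y - g x = (g y - g x) / (y - x) * (y - x)).
  { intros y Hy; field; lra. }
  split; intros y Hy.
  - assert (Hyx : y <> x) by lra.
    specialize (Hm y Hyx); specialize (Hq y Hyx); rewrite Rabs_right in Hq by lra.
    assert (Hq' := Hq ltac:(lra)); nra.
  - assert (Hyx : y <> x) by lra.
    specialize (Hm y Hyx); specialize (Hq y Hyx); rewrite Rabs_left in Hq by lra.
    assert (Hq' := Hq ltac:(lra)); nra.
Qed.

Lemma intermediate_value : forall (g : R -> R) (a b y : R),
  a <= b -> (forall x, continuous g x) -> g a <= y <= g b \/ g b <= y <= g a ->
  exists x, a <= x <= b /\ g x = y.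
Proof.
  intros g a b y Hab Hc Hy.
  destruct (IVT_gen g a b y) as [x [Hx Hx']].
  - intros x; apply continuity_pt_filterlim, Hc.
  - destruct Hy; [rewrite Rmin_left, Rmax_right by lra | rewrite Rmin_right, Rmax_left by lra]; lra.
  - rewrite Rmin_left, Rmax_right in Hx by lra; exists x; auto.
Qed.

Lemma is_lim_infty_eps : forall (g : R -> R) (l : R),
  is_lim g p_infty l ->
  forall eps, 0 < eps -> exists Z, forall z, Z < z -> Rabs (g z - l) < eps.
Proof.
  intros g l H eps He; apply is_lim_spec in H.
  destruct (H (mkposreal eps He)) as [Z HZ]; exists Z; exact HZ.
Qed.

(** The facts about the profile on which the parabolic part relies; Q is
    continued linearly, hence negatively, below 0. *)
Record profile (f : R -> R) (mu c : R) (Q dQ ddQ : R -> R) : Prop := {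
  pf_ode : profile_ode f c Q dQ ddQ;
  pf_zero : Q 0 = 0;
  pf_slope : c = mu * dQ 0;
  pf_speed : 0 < c;
  pf_incr : forall z, 0 < dQ z;
  pf_lt1 : forall z, Q z < 1;
  pf_lim : forall eps, 0 < eps -> exists Z, forall z, Z < z -> 1 - eps < Q z;
  pf_flat : forall eps, 0 < eps -> exists Z, forall z, Z < z -> dQ z < eps
}.

(** A critical value of the profile is never taken before: the energy
    dQ^2/2 + F(Q), with F a primitive of f, is nondecreasing as c > 0, and
    at a critical point it reduces to F(Q), its least possible value at that
    height. *)
Lemma profile_critical_value_is_new : forall f df c Q dQ ddQ z0,
  reaction f df -> profile_ode f c Q dQ ddQ -> 0 < c -> Q 0 = 0 ->
  (forall z, 0 < z -> 0 < Q z) ->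
  0 < z0 -> dQ z0 = 0 -> forall z, 0 <= z < z0 -> Q z < Q z0.
Proof.
  intros f df c Q dQ ddQ z0 Hf HQ Hc HQ0 Hpos Hz0 Hd0.
  assert (Hfc : forall v, continuous f v)
    by (intros v; apply (is_derive_continuous f v (df v)), Hf).
  set (F := fun v => RInt f 0 v).
  assert (HF : forall v, is_derive F v (f v)).
  { intros v; apply (is_derive_RInt f F 0 v); [| apply Hfc].
    exists (mkposreal 1 Rlt_0_1); intros y _.
    apply (RInt_correct f), ex_RInt_continuous; intros; apply Hfc. }
  set (E := fun z => dQ z * dQ z / 2 + F (Q z)).
  assert (HE : forall z, 0 < z -> is_derive E z (c * (dQ z * dQ z))).
  { intros z Hz; unfold E.
    assert (H1 := po_Q _ _ _ _ _ HQ z); assert (H2 := po_dQ _ _ _ _ _ HQ z Hz).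
    assert (H3 := HF (Q z)).
    auto_derive.
    - repeat split; first [exists (ddQ z); exact H2 | exists (f (Q z)); exact H3 | exists (dQ z); exact H1].
    - subst_derive H3; subst_derive H1; subst_derive H2.
      rewrite (po_eq _ _ _ _ _ HQ z Hz); field. }
  assert (HEc : forall z, 0 < z -> continuous E z).
  { intros z Hz; apply (is_derive_continuous _ _ _ (HE z Hz)). }
  assert (HEm : forall x y, 0 < x -> x <= y -> E x <= E y).
  { intros x y Hx Hxy; apply (nondecreasing_of_derivative E (fun z => c * (dQ z * dQ z))).
    - exact Hxy.
    - intros z Hz; apply HE; lra.
    - intros z Hz; apply HEc; lra.
    - intros z _; apply Rmult_le_pos; [lra | apply Rle_0_sqr]. }
  assert (Hne : forall z, 0 < z < z0 -> Q z <> Q z0).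
  { intros z Hz Heq.
    assert (HEz : E z0 <= E z).
    { unfold E; rewrite Hd0, Heq; generalize (Rle_0_sqr (dQ z)); unfold Rsqr; lra. }
    assert (Hcst : forall y, z <= y <= z0 -> E y = E z0).
    { intros y Hy; generalize (HEm z y) (HEm y z0); intros H1 H2.
      apply Rle_antisym; [apply H2; lra |]. apply Rle_trans with (1 := HEz); apply H1; lra. }
    assert (Hd : forall y, z < y < z0 -> dQ y = 0).
    { intros y Hy.
      assert (H1 : is_derive E y 0).
      { apply (is_derive_ext_near (fun _ => E z0) E y 0 (Rmin (y - z) (z0 - y))).
        - apply Rmin_glb_lt; lra.
        - intros x Hx; generalize (Rmin_l (y - z) (z0 - y)) (Rmin_r (y - z) (z0 - y)).
          intros; apply Rabs_def2 in Hx; symmetry; apply Hcst; lra.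
        - apply (@is_derive_const R_AbsRing R_NormedModule). }
      assert (Hy0 : 0 < y) by lra.
      generalize (is_derive_unique _ _ _ (HE y Hy0)).
      rewrite (is_derive_unique _ _ _ H1); intros H2.
      apply Rsqr_0_uniq; unfold Rsqr; nra. }
    set (y := (z + z0) / 2).
    assert (Hy : z < y < z0) by (unfold y; lra).
    assert (Hy0 : 0 < y) by lra.
    assert (H1 : is_derive dQ y 0).
    { apply (is_derive_ext_near (fun _ => 0) dQ y 0 (z0 - y)); [lra | |].
      - intros x Hx; apply Rabs_def2 in Hx; symmetry; apply Hd; unfold y in *; lra.
      - apply (@is_derive_const R_AbsRing R_NormedModule). }
    assert (Hdd : ddQ y = 0).
    { rewrite <- (is_derive_unique _ _ _ (po_dQ _ _ _ _ _ HQ y Hy0)).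
      apply is_derive_unique, H1. }
    rewrite (po_eq _ _ _ _ _ HQ y Hy0), (Hd y Hy) in Hdd.
    assert (HQy : Q 0 = Q y).
    { apply (profile_rest_point f df c Q dQ ddQ y Hf HQ); [lra | auto | lra | lra]. }
    generalize (Hpos y Hy0); lra. }
  intros z Hz; apply Rnot_le_lt; intros Hle.
  destruct (intermediate_value Q 0 z (Q z0)) as [w [Hw Hw']];
    [lra | apply (po_Q_cont _ _ _ _ _ HQ) | left; generalize (Hpos z0 Hz0); lra |].
  destruct (Req_dec w 0) as [-> | Hw0]; [generalize (Hpos z0 Hz0); lra |].
  apply (Hne w); [lra | exact Hw'].
Qed.

(** At a critical point the profile would have a strict maximum, and then a
    later minimum on its way up to 1, at a value already taken. *)
Lemma profile_no_critical_point : forall f df c Q dQ ddQ,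
  reaction f df -> profile_ode f c Q dQ ddQ -> 0 < c -> Q 0 = 0 ->
  (forall z, 0 < z -> 0 < Q z) -> is_lim Q p_infty 1 ->
  forall z0, 0 < z0 -> dQ z0 <> 0.
Proof.
  intros f df c Q dQ ddQ Hf HQ Hc HQ0 Hpos Hlim z0 Hz0 Hd0.
  assert (Hnew := fun z Hz Hd =>
    profile_critical_value_is_new f df c Q dQ ddQ z Hf HQ Hc HQ0 Hpos Hz Hd).
  assert (Hdd := po_dQ _ _ _ _ _ HQ z0 Hz0).
  rewrite (po_eq _ _ _ _ _ HQ z0 Hz0), Hd0, Rmult_0_r in Hdd.
  assert (Hmv : forall x y, x < y -> exists w, x < w < y /\ Q y - Q x = dQ w * (y - x)).
  { intros x y Hxy; apply mean_value; [exact Hxy | intros; apply HQ |].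
    intros; apply (po_Q_cont _ _ _ _ _ HQ). }
  destruct (Rtotal_order (f (Q z0)) 0) as [Hn | [Hz | Hp]].
  - destruct (is_derive_pos_sides dQ z0 _ Hdd) as [d [Hd [_ Hl]]]; [lra |].
    set (k := Rmin d z0 / 2).
    assert (0 < k /\ k < d /\ k < z0) as [Hk [Hkd Hke]].
    { unfold k; generalize (Rmin_l d z0) (Rmin_r d z0) (Rmin_glb_lt _ _ _ Hd Hz0); lra. }
    destruct (Hmv (z0 - k) z0) as [w [Hw Hw']]; [lra |].
    assert (Q (z0 - k) < Q z0) by (apply Hnew; [lra | exact Hd0 | lra]).
    assert (dQ w < dQ z0) by (apply Hl; lra). nra.
  - assert (Q 0 = Q z0).
    { apply (profile_rest_point f df c Q dQ ddQ z0 Hf HQ); auto; lra. }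
    generalize (Hpos z0 Hz0); lra.
  - assert (Ha : Q z0 < 1).
    { apply Rnot_le_lt; intros [H | H].
      - generalize (re_above _ _ Hf _ H); lra.
      - rewrite <- H, (re_one _ _ Hf) in Hp; lra. }
    destruct (is_derive_pos_sides (fun z => - dQ z) z0 (- (0 - f (Q z0)))) as [d [Hd [Hr _]]].
    { apply (is_derive_opp dQ), Hdd. }
    { lra. }
    destruct (Hmv z0 (z0 + d / 2)) as [w [Hw Hw']]; [lra |].
    assert (Hdw : - dQ z0 < - dQ w) by (apply Hr; lra).
    assert (Hlow : Q (z0 + d / 2) < Q z0) by nra.
    destruct (is_lim_infty_eps Q 1 Hlim (1 - Q z0)) as [Z HZ]; [lra |].
    set (z3 := Rmax Z (z0 + d / 2) + 1).
    assert (Hz3 : Z < z3 /\ z0 + d / 2 < z3).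
    { unfold z3; generalize (Rmax_l Z (z0 + d / 2)) (Rmax_r Z (z0 + d / 2)); lra. }
    assert (H3 : Q z0 < Q z3).
    { specialize (HZ z3 (proj1 Hz3)); apply Rabs_def2 in HZ; lra. }
    destruct (continuity_ab_min Q z0 z3) as [zm [Hm Hzm]].
    { lra. }
    { intros x _; apply continuity_pt_filterlim, (po_Q_cont _ _ _ _ _ HQ). }
    assert (Q zm <= Q (z0 + d / 2)) by (apply Hm; lra).
    assert (zm <> z0) by (intros ->; lra).
    assert (zm <> z3) by (intros ->; lra).
    assert (Hdm : dQ zm = 0).
    { apply (is_derive_local_min Q zm _ (Rmin (zm - z0) (z3 - zm))).
      - apply HQ.
      - apply Rmin_glb_lt; lra.
      - intros y Hy; generalize (Rmin_l (zm - z0) (z3 - zm)) (Rmin_r (zm - z0) (z3 - zm)).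
        intros; apply Rabs_def2 in Hy; apply Hm; lra. }
    assert (Q z0 < Q zm) by (apply Hnew; [lra | exact Hdm | lra]).
    lra.
Qed.

Lemma profile_of_semi_wave : forall f df mu c Q dQ ddQ,
  reaction f df -> profile_ode f c Q dQ ddQ -> 0 < mu ->
  (forall z, z <= 0 -> dQ z = dQ 0) ->
  Q 0 = 0 -> (forall z, 0 < z -> 0 < Q z) -> is_lim Q p_infty 1 -> dQ 0 = c / mu ->
  profile f mu c Q dQ ddQ.
Proof.
  intros f df mu c Q dQ ddQ Hf HQ Hmu Hneg HQ0 Hpos Hlim Hbd.
  assert (Hslope : c = mu * dQ 0) by (rewrite Hbd; field; lra).
  assert (Hd0 : 0 < dQ 0).
  { assert (Hge : 0 <= dQ 0).
    { apply Rnot_lt_le; intros Hlt.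
      destruct (is_derive_pos_sides (fun z => - Q z) 0 (- dQ 0)) as [d [Hd [Hr _]]].
      - apply (is_derive_opp Q), HQ.
      - lra.
      - assert (- Q 0 < - Q (d / 2)) by (apply Hr; lra).
        assert (0 < Q (d / 2)) by (apply Hpos; lra). lra. }
    destruct Hge as [| Hz]; [assumption | exfalso].
    assert (Q 1 = Q 0).
    { apply (profile_rest_point f df c Q dQ ddQ 0 Hf HQ); try lra.
      rewrite HQ0; apply Hf. }
    assert (0 < Q 1) by (apply Hpos; lra). lra. }
  assert (Hc : 0 < c) by (rewrite Hslope; apply Rmult_lt_0_compat; assumption).
  assert (Hinc : forall z, 0 < dQ z).
  { intros z; destruct (Rle_lt_dec z 0) as [Hz | Hz]; [rewrite Hneg; assumption |].
    apply Rnot_le_lt; intros Hle.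
    destruct (intermediate_value dQ 0 z 0) as [w [Hw Hw']];
      [lra | apply HQ | right; lra |].
    destruct (Req_dec w 0) as [-> | Hw0]; [lra |].
    apply (profile_no_critical_point f df c Q dQ ddQ Hf HQ Hc HQ0 Hpos Hlim w); [lra | exact Hw']. }
  assert (Hmv : forall x y, x < y -> exists w, x < w < y /\ Q y - Q x = dQ w * (y - x)).
  { intros x y Hxy; apply mean_value; [exact Hxy | intros; apply HQ |].
    intros; apply (po_Q_cont _ _ _ _ _ HQ). }
  assert (Hlt : forall x y, x < y -> Q x < Q y).
  { intros x y Hxy; destruct (Hmv x y Hxy) as [w [Hw H]].
    specialize (Hinc w); nra. }
  assert (Hlt1 : forall z, Q z < 1).
  { intros z; apply Rnot_le_lt; intros Hle.
    assert (H1 := Hlt z (z + 1) ltac:(lra)).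
    destruct (is_lim_infty_eps Q 1 Hlim (Q (z + 1) - 1)) as [Z HZ]; [lra |].
    assert (Hmx : Z < Rmax Z (z + 1) + 1 /\ z + 1 < Rmax Z (z + 1) + 1).
    { generalize (Rmax_l Z (z + 1)) (Rmax_r Z (z + 1)); lra. }
    specialize (HZ _ (proj1 Hmx)); apply Rabs_def2 in HZ.
    generalize (Hlt _ _ (proj2 Hmx)); lra. }
  constructor; try assumption.
  - intros eps He; destruct (is_lim_infty_eps Q 1 Hlim eps He) as [Z HZ].
    exists Z; intros z Hz; specialize (HZ z Hz); apply Rabs_def2 in HZ; lra.
  - intros eps He.
    destruct (proj1 (continuous_R_eps f 1) (is_derive_continuous _ _ _ (re_derive _ _ Hf 1))
                (c * eps / 2)) as [d [Hd Hfd]]; [nra |].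
    destruct (is_lim_infty_eps Q 1 Hlim d Hd) as [Z HZ].
    exists (Rmax Z 1); intros z0 Hz0.
    assert (HZ0 : Z < z0 /\ 1 < z0)
      by (generalize (Rmax_l Z 1) (Rmax_r Z 1); lra).
    apply Rnot_le_lt; intros Hge.
    (* past z0 the term -f(Q) cannot bring the slope back below eps *)
    assert (Hstay : forall z, z0 <= z -> eps / 2 <= dQ z).
    { intros z Hz.
      assert (H : exp (- c * z0) * (dQ z0 - eps / 2) <= exp (- c * z) * (dQ z - eps / 2)).
      { apply (nondecreasing_of_derivative (fun x => exp (- c * x) * (dQ x - eps / 2))
                 (fun x => exp (- c * x) * (c * eps / 2 - f (Q x)))).
        - exact Hz.
        - intros x Hx; assert (Hx0 : 0 < x) by lra.
          assert (H2 := po_dQ _ _ _ _ _ HQ x Hx0).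
          auto_derive; [exists (ddQ x); exact H2 |].
          subst_derive H2; rewrite (po_eq _ _ _ _ _ HQ x Hx0); field.
        - intros x Hx.
          apply (continuous_mult (fun x => exp (- c * x)) (fun x => dQ x - eps / 2)).
          + apply (is_derive_continuous _ _ (- c * exp (- c * x))); auto_derive; [trivial | ring].
          + apply (continuous_minus dQ (fun _ => eps / 2)); [apply HQ | apply continuous_const].
        - intros x Hx; apply Rmult_le_pos; [left; apply exp_pos |].
          assert (HQx : Rabs (Q x - 1) < d) by (apply HZ; lra).
          specialize (Hfd _ HQx); rewrite (re_one _ _ Hf) in Hfd.
          apply Rabs_def2 in Hfd; lra. }
      assert (0 <= exp (- c * z0) * (dQ z0 - eps / 2)).
      { apply Rmult_le_pos; [left; apply exp_pos | lra]. }
      generalize (exp_pos (- c * z)); intros; nra. }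
    destruct (Hmv z0 (z0 + 4 / eps)) as [w [Hw H]].
    { assert (0 < 4 / eps) by (apply Rdiv_lt_0_compat; lra); lra. }
    assert (Hw2 : eps / 2 <= dQ w) by (apply Hstay; lra).
    assert (H4 : 2 <= dQ w * (4 / eps)).
    { apply Rle_trans with (eps / 2 * (4 / eps)); [right; field; lra |].
      apply Rmult_le_compat_r; [| exact Hw2].
      left; apply Rdiv_lt_0_compat; lra. }
    generalize (Hlt1 (z0 + 4 / eps)) (Hpos z0 ltac:(lra)); intros.
    replace (z0 + 4 / eps - z0) with (4 / eps) in H by ring. lra.
Qed.

(** * Comparison with barriers *)

Lemma is_cv_le : forall s r l m,
  (forall n, s n <= r n) -> is_cv s l -> is_cv r m -> l <= m.
Proof.
  intros s r l m H Hs Hr; exact (is_lim_seq_le s r l m H Hs Hr).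
Qed.

Lemma is_cv_const : forall l, is_cv (fun _ => l) l.
Proof. intros l; apply is_lim_seq_const. Qed.

Lemma is_cv_comp : forall g s l,
  continuous g l -> is_cv s l -> is_cv (fun n => g (s n)) (g l).
Proof.
  intros g s l Hg Hs; apply is_lim_seq_continuous; [| exact Hs].
  apply continuity_pt_filterlim, Hg.
Qed.

Lemma is_cv_minus : forall s r l m,
  is_cv s l -> is_cv r m -> is_cv (fun n => s n - r n) (l - m).
Proof. intros; apply is_lim_seq_minus'; assumption. Qed.

Lemma is_cv_mult : forall s r l m,
  is_cv s l -> is_cv r m -> is_cv (fun n => s n * r n) (l * m).
Proof. intros; apply is_lim_seq_mult'; assumption. Qed.

(** An entire solution of the Stefan problem, with the differentiability and
    continuity in the form used by the maximum principle; [f] is defined on the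
    whole line. *)
Record stefan (f : R -> R) (mu : R) (u : R -> R -> R) (h : R -> R)
    (ut ux uxx : R -> R -> R) (dh : R -> R) : Prop := {
  st_h : forall t, is_derive h t (dh t);
  st_t : forall t x, x < h t -> is_derive (fun r => u r x) t (ut t x);
  st_x : forall t x, x < h t -> is_derive (u t) x (ux t x);
  st_left : forall t, left_derivative (u t) (h t) (ux t (h t));
  st_xx : forall t x, x < h t -> is_derive (ux t) x (uxx t x);
  st_cont : forall tn xn t x, (forall n, xn n <= h (tn n)) -> is_cv tn t -> is_cv xn x ->
              is_cv (fun n => u (tn n) (xn n)) (u t x);
  st_eq : forall t x, x < h t -> ut t x = uxx t x + f (u t x);
  st_zero : forall t, u t (h t) = 0;
  st_free : forall t, dh t = - mu * ux t (h t);
  st_pos : forall t x, x < h t -> 0 < u t x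
}.

(** Regularity of a function of (t, x) on the whole plane; differentiability
    in t is required along every differentiable curve, in particular along the
    free boundary. The second derivative is needed only where U is positive,
    after the initial time t0. *)
Record barrier (t0 : R) (U Ut Ux Uxx : R -> R -> R) : Prop := {
  ba_cont : forall tn xn t x, is_cv tn t -> is_cv xn x ->
              is_cv (fun n => U (tn n) (xn n)) (U t x);
  ba_curve : forall g t v, is_derive g t v ->
              is_derive (fun r => U r (g r)) t (Ut t (g t) + Ux t (g t) * v);
  ba_x : forall t x, is_derive (U t) x (Ux t x);
  ba_xx : forall t x, t0 < t -> 0 < U t x -> is_derive (Ux t) x (Uxx t x)
}.

Lemma ba_t : forall t0 U Ut Ux Uxx, barrier t0 U Ut Ux Uxx ->
  forall t x, is_derive (fun r => U r x) t (Ut t x).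
Proof.
  intros t0 U Ut Ux Uxx H t x.
  assert (H1 := ba_curve _ _ _ _ _ H (fun _ => x) t 0
                  (@is_derive_const R_AbsRing R_NormedModule x t)).
  simpl in H1; rewrite Rmult_0_r, Rplus_0_r in H1; exact H1.
Qed.

Lemma left_derivative_scaled_minus : forall s g k x l m,
  s = 1 \/ s = -1 ->
  left_derivative g x l -> left_derivative k x m ->
  left_derivative (fun y => s * (g y - k y)) x (s * (l - m)).
Proof.
  intros s g k x l m Hs Hg Hk eps He.
  destruct (Hg (eps / 2)) as [d1 [Hd1 H1]]; [lra |].
  destruct (Hk (eps / 2)) as [d2 [Hd2 H2]]; [lra |].
  exists (Rmin d1 d2); split; [apply Rmin_glb_lt; assumption |].
  intros y Hy; generalize (Rmin_l d1 d2) (Rmin_r d1 d2); intros.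
  assert (A1 := H1 y ltac:(lra)); assert (A2 := H2 y ltac:(lra)).
  apply Rabs_def2 in A1; apply Rabs_def2 in A2.
  replace ((s * (g y - k y) - s * (g x - k x)) / (y - x) - s * (l - m))
    with (s * (((g y - g x) / (y - x) - l) - ((k y - k x) / (y - x) - m)))
    by (field; lra).
  set (a := (g y - g x) / (y - x) - l) in *; set (b := (k y - k x) / (y - x) - m) in *.
  destruct Hs as [-> | ->]; apply Rabs_def1; lra.
Qed.

Lemma is_derive_scaled_minus : forall s g k x l m,
  is_derive g x l -> is_derive k x m ->
  is_derive (fun y => s * (g y - k y)) x (s * (l - m)).
Proof.
  intros s g k x l m Hg Hk.
  apply (is_derive_scal (fun y => g y - k y) x s (l - m)).
  apply (is_derive_minus g k x l m Hg Hk).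
Qed.

Lemma near_of_continuous : forall (g : R -> R) (x : R),
  continuous g x -> 0 < g x ->
  exists d, 0 < d /\ forall y, x - d < y < x + d -> 0 < g y.
Proof.
  intros g x Hc Hp; destruct (continuous_pos_near g x Hc Hp) as [d [Hd H]].
  exists d; split; [exact Hd |]; intros y Hy; apply H, Rabs_def1; lra.
Qed.

Lemma continuous_minus_R : forall (g k : R -> R) (x : R),
  continuous g x -> continuous k x -> continuous (fun y => g y - k y) x.
Proof. intros g k x Hg Hk; apply (continuous_minus g k x Hg Hk). Qed.

(** Comparison of a solution with a strict supersolution (s = 1) or
    subsolution (s = -1) U over a region between two curves. In level set form
    the free boundary condition h' = - mu u_x on u = 0 reads
    U_t = mu U_x^2, which spares U an explicit free boundary. At a first
    contact point inside, the strict differential inequality is violated; at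
    one on the free boundary, U - u orders the slopes there and with them the
    speeds, which violates the strict boundary inequality. *)
Lemma barrier_comparison : forall s f mu u h ut ux uxx dh U Ut Ux Uxx lo hi t0 t1,
  s = 1 \/ s = -1 -> 0 < mu ->
  stefan f mu u h ut ux uxx dh ->
  barrier t0 U Ut Ux Uxx ->
  (forall t, continuous lo t) -> (forall t, continuous hi t) ->
  (forall t x, t0 < t <= t1 -> lo t < x < hi t -> x < h t -> U t x = u t x ->
     0 < s * (Ut t x - Uxx t x - f (U t x))) ->
  (forall t x, t0 < t <= t1 -> lo t < x < hi t -> x = h t -> U t x = 0 ->
     Ux t x < 0 /\ 0 < s * (Ut t x - mu * (Ux t x * Ux t x))) ->
  (forall x, lo t0 <= x <= hi t0 -> x <= h t0 -> 0 < s * (U t0 x - u t0 x)) ->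
  (forall t, t0 <= t <= t1 -> lo t <= h t -> 0 < s * (U t (lo t) - u t (lo t))) ->
  (forall t, t0 <= t <= t1 -> hi t <= h t -> 0 < s * (U t (hi t) - u t (hi t))) ->
  forall t x, t0 <= t <= t1 -> lo t <= x <= hi t -> x <= h t ->
    0 < s * (U t x - u t x).
Proof.
  intros s f mu u h ut ux uxx dh U Ut Ux Uxx lo hi t0 t1 Hs Hmu Hu HU Hlo Hhi
    Hint Hbd Hini Hlat_lo Hlat_hi ta xa Hta Hxa Hxha.
  apply Rnot_le_lt; intros Hbad.
  assert (Hhc : forall t, continuous h t)
    by (intros t; apply (is_derive_continuous h t (dh t)), Hu).
  destruct (continuous_bounded lo t0 t1) as [M1 [HM1 HB1]]; [lra | auto |].
  destruct (continuous_bounded hi t0 t1) as [M2 [HM2 HB2]]; [lra | auto |].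
  set (M := M1 + M2 + Rabs t0 + Rabs t1).
  set (B := fun t x y => y = t /\ t0 <= t <= t1 /\ lo t <= x <= hi t /\ x <= h t /\
              s * (U t x - u t x) <= 0).
  destruct (earliest_point B (- M) M) as [t [x [y [HBt Hfirst]]]].
  { intros t x y [-> [Ht [Hx _]]].
    generalize (HB1 t Ht) (HB2 t Ht); intros A1 A2.
    apply Rabs_le_between in A1; apply Rabs_le_between in A2.
    generalize (Rabs_pos t0) (Rabs_pos t1) (Rle_abs t1) (Rle_abs (- t0)).
    rewrite (Rabs_Ropp t0); unfold M; intros.
    generalize (Rle_abs t0) (Rle_abs (- t1)); rewrite (Rabs_Ropp t1); intros.
    repeat split; lra. }
  { intros tn xn yn t x y HB Ht Hx Hy; unfold B in HB |- *.
    assert (Hy' : is_cv tn y).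
    { apply (is_lim_seq_ext yn tn); [intros n; apply HB | exact Hy]. }
    assert (Hyt : y = t).
    { apply is_lim_seq_unique in Hy'; apply is_lim_seq_unique in Ht.
      rewrite Hy' in Ht; injection Ht; auto. }
    split; [exact Hyt |]. split; [split |].
    - apply (is_cv_le (fun _ => t0) tn); [intros n; apply HB | apply is_cv_const | exact Ht].
    - apply (is_cv_le tn (fun _ => t1)); [intros n; apply HB | exact Ht | apply is_cv_const].
    - split; [split |]; [| | split].
      + apply (is_cv_le (fun n => lo (tn n)) xn);
          [intros n; apply HB | apply is_cv_comp; auto | exact Hx].
      + apply (is_cv_le xn (fun n => hi (tn n)));
          [intros n; apply HB | exact Hx | apply is_cv_comp; auto].
      + apply (is_cv_le xn (fun n => h (tn n)));
          [intros n; apply HB | exact Hx | apply is_cv_comp; auto].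
      + apply (is_cv_le (fun n => s * (U (tn n) (xn n) - u (tn n) (xn n))) (fun _ => 0));
          [intros n; apply HB | | apply is_cv_const].
        apply is_cv_mult; [apply is_cv_const |]; apply is_cv_minus.
        * apply (ba_cont _ _ _ _ _ HU); assumption.
        * apply (st_cont _ _ _ _ _ _ _ _ Hu); [intros n; apply HB | |]; assumption. }
  { exists ta, xa, ta; unfold B; repeat split; try assumption; lra. }
  destruct HBt as [_ [Ht [Hx [Hxh Hw]]]].
  assert (Hbefore : forall r z, t0 <= r < t -> lo r <= z <= hi r -> z <= h r ->
            0 < s * (U r z - u r z)).
  { intros r z Hr Hz Hzh; apply Rnot_le_lt; intros Hle.
    assert (t <= r); [| lra].
    apply (Hfirst r z r); unfold B; repeat split; lra. }
  assert (Ht0 : t0 < t).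
  { destruct (proj1 Ht) as [| <-]; [assumption |].
    specialize (Hini x Hx Hxh); lra. }
  assert (Hxlo : lo t < x).
  { destruct (proj1 Hx) as [| <-]; [assumption |].
    specialize (Hlat_lo t Ht Hxh); lra. }
  assert (Hxhi : x < hi t).
  { destruct (proj2 Hx) as [| ->]; [assumption |].
    specialize (Hlat_hi t Ht Hxh); lra. }
  assert (Hearlier : forall g, continuous g t -> lo t < g t < hi t ->
            exists d, 0 < d /\ forall r, t - d < r < t ->
              t0 <= r < t /\ lo r <= g r <= hi r).
  { intros g Hg Hgt.
    destruct (near_of_continuous (fun r => g r - lo r) t) as [d1 [Hd1 H1]];
      [apply continuous_minus_R; auto | lra |].
    destruct (near_of_continuous (fun r => hi r - g r) t) as [d2 [Hd2 H2]];
      [apply continuous_minus_R; auto | lra |].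
    exists (Rmin (Rmin d1 d2) (t - t0)); split.
    - repeat apply Rmin_glb_lt; lra.
    - intros r; generalize (Rmin_l (Rmin d1 d2) (t - t0)) (Rmin_r (Rmin d1 d2) (t - t0))
        (Rmin_l d1 d2) (Rmin_r d1 d2); intros.
      specialize (H1 r ltac:(lra)); specialize (H2 r ltac:(lra)); lra. }
  assert (Hearlier_in : forall z, lo t < z < hi t -> z < h t ->
            exists d, 0 < d /\ forall r, t - d < r < t -> 0 < s * (U r z - u r z)).
  { intros z Hz Hzh.
    destruct (Hearlier (fun _ => z)) as [d1 [Hd1 H1]]; [apply continuous_const | exact Hz |].
    destruct (near_of_continuous (fun r => h r - z) t) as [d2 [Hd2 H2]];
      [apply continuous_minus_R; [auto | apply continuous_const] | lra |].
    exists (Rmin d1 d2); split; [apply Rmin_glb_lt; lra |]; intros r Hr.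
    generalize (Rmin_l d1 d2) (Rmin_r d1 d2); intros.
    destruct (H1 r ltac:(lra)) as [A1 A2]; specialize (H2 r ltac:(lra)).
    apply Hbefore; [exact A1 | exact A2 | lra]. }
  assert (Hder_t : forall z, z < h t ->
            is_derive (fun r => s * (U r z - u r z)) t (s * (Ut t z - ut t z))).
  { intros z Hz; apply (is_derive_scaled_minus s (fun r => U r z) (fun r => u r z)).
    - apply (ba_t _ _ _ _ _ HU).
    - apply Hu, Hz. }
  assert (Hnow : forall z, lo t < z < hi t -> z < h t -> 0 <= s * (U t z - u t z)).
  { intros z Hz Hzh; destruct (Hearlier_in z Hz Hzh) as [d [Hd H]].
    apply (continuous_nonneg_left (fun r => s * (U r z - u r z)) t d);
      [apply (is_derive_continuous _ _ _ (Hder_t z Hzh)) | exact Hd |].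
    intros r Hr; left; apply H, Hr. }
  set (d := Rmin (x - lo t) (hi t - x)).
  assert (Hd : 0 < d) by (apply Rmin_glb_lt; lra).
  assert (Hdin : forall z, Rabs (z - x) < d -> lo t < z < hi t).
  { intros z Hz; apply Rabs_def2 in Hz; unfold d in Hz.
    generalize (Rmin_l (x - lo t) (hi t - x)) (Rmin_r (x - lo t) (hi t - x)); lra. }
  destruct Hxh as [Hxh | Hxh].
  - (* inside, U - u has a minimum in x and has just come down to 0 in t *)
    assert (Hw0 : s * (U t x - u t x) = 0).
    { apply Rle_antisym; [exact Hw | apply Hnow; [lra | exact Hxh]]. }
    assert (HUu : U t x = u t x) by (destruct Hs as [-> | ->]; lra).
    destruct (Hearlier_in x (conj Hxlo Hxhi) Hxh) as [e [He Hbef]].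
    assert (T1 : s * (Ut t x - ut t x) <= 0).
    { apply (left_derivative_nonpos _ t _ e (is_derive_left _ _ _ (Hder_t x Hxh)) He).
      intros r Hr; rewrite Hw0; left; apply Hbef, Hr. }
    set (d' := Rmin d (h t - x)).
    assert (Hd' : 0 < d') by (apply Rmin_glb_lt; lra).
    assert (Hd'in : forall z, Rabs (z - x) < d' -> lo t < z < hi t /\ z < h t).
    { intros z Hz; generalize (Rmin_l d (h t - x)) (Rmin_r d (h t - x)).
      fold d'; intros; split; [apply Hdin; lra |].
      apply Rabs_def2 in Hz; lra. }
    assert (T2 : 0 <= s * (Uxx t x - uxx t x)).
    { apply (second_derivative_local_min (fun z => s * (U t z - u t z))
               (fun z => s * (Ux t z - ux t z)) x _ d' Hd').
      - intros z Hz; apply is_derive_scaled_minus;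
          [apply (ba_x _ _ _ _ _ HU) | apply Hu, (Hd'in z Hz)].
      - apply is_derive_scaled_minus; [| apply Hu, Hxh].
        apply (ba_xx _ _ _ _ _ HU); [exact Ht0 |]; rewrite HUu; apply Hu, Hxh.
      - intros z Hz; rewrite Hw0; apply Hnow; apply (Hd'in z Hz). }
    assert (T3 := Hint t x (conj Ht0 (proj2 Ht)) (conj Hxlo Hxhi) Hxh HUu).
    rewrite HUu in T3; rewrite (st_eq _ _ _ _ _ _ _ _ Hu t x Hxh) in T1.
    nra.
  - (* on the free boundary, u vanishes along (t, h t), so that U alone must come
       down to 0 along that curve, while U - u is minimal there in x *)
    assert (Hdc : is_derive (fun r => s * U r (h r)) t (s * (Ut t x + Ux t x * dh t))).
    { rewrite Hxh.
      apply (is_derive_scal (fun r => U r (h r))), (ba_curve _ _ _ _ _ HU), Hu. }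
    destruct (Hearlier h) as [e [He Hbef]]; [auto | rewrite <- Hxh; lra |].
    assert (Hpos : forall r, t - e < r < t -> 0 < s * U r (h r)).
    { intros r Hr; destruct (Hbef r Hr) as [A1 A2].
      generalize (Hbefore r (h r) A1 A2 (Rle_refl _)).
      rewrite (st_zero _ _ _ _ _ _ _ _ Hu), Rminus_0_r; auto. }
    assert (HU0 : s * U t (h t) = 0).
    { apply Rle_antisym.
      - rewrite Hxh, (st_zero _ _ _ _ _ _ _ _ Hu), Rminus_0_r in Hw; exact Hw.
      - apply (continuous_nonneg_left (fun r => s * U r (h r)) t e);
          [apply (is_derive_continuous _ _ _ Hdc) | exact He |].
        intros r Hr; left; apply Hpos, Hr. }
    assert (T1 : s * (Ut t x + Ux t x * dh t) <= 0).
    { apply (left_derivative_nonpos _ t _ e (is_derive_left _ _ _ Hdc) He).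
      intros r Hr; rewrite HU0; left; apply Hpos, Hr. }
    assert (HUx : U t x = 0) by (rewrite Hxh; destruct Hs as [-> | ->]; lra).
    destruct (Hbd t x (conj Ht0 (proj2 Ht)) (conj Hxlo Hxhi) Hxh HUx) as [S1 S2].
    assert (T2 : s * (Ux t x - ux t x) <= 0).
    { apply (left_derivative_nonpos (fun z => s * (U t z - u t z)) x _ d).
      - apply left_derivative_scaled_minus; [exact Hs | |].
        + apply is_derive_left, (ba_x _ _ _ _ _ HU).
        + rewrite Hxh; apply (st_left _ _ _ _ _ _ _ _ Hu).
      - exact Hd.
      - intros z Hz.
        replace (s * (U t x - u t x)) with 0
          by (rewrite HUx, Hxh, (st_zero _ _ _ _ _ _ _ _ Hu); ring).
        apply Hnow; [apply Hdin; rewrite Rabs_left; lra | lra]. }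
    rewrite (st_free _ _ _ _ _ _ _ _ Hu), <- Hxh in T1.
    assert (0 <= mu * (- Ux t x) * (- (s * (Ux t x - ux t x)))).
    { apply Rmult_le_pos; [apply Rmult_le_pos |]; lra. }
    nra.
Qed.

Lemma is_derive_comp_R : forall (g k : R -> R) (x l m : R),
  is_derive g (k x) l -> is_derive k x m -> is_derive (fun y => g (k y)) x (l * m).
Proof.
  intros g k x l m Hg Hk; rewrite Rmult_comm; apply (is_derive_comp g k x l m Hg Hk).
Qed.

Lemma is_derive_mult_R : forall (g k : R -> R) (x l m : R),
  is_derive g x l -> is_derive k x m ->
  is_derive (fun y => g y * k y) x (l * k x + g x * m).
Proof.
  intros g k x l m Hg Hk; apply (is_derive_mult g k x l m Hg Hk).
  intros a b; apply Rmult_comm.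
Qed.

(** The barriers that follow the front are built from the profile, by
    amplification in time and a smooth change of variables. *)
Lemma profile_barrier : forall t0 f mu c Q dQ ddQ P dP Z Zt Zx Zxx,
  profile f mu c Q dQ ddQ ->
  (forall t, t0 < t -> 0 < P t) -> (forall t, is_derive P t (dP t)) ->
  (forall tn xn t x, is_cv tn t -> is_cv xn x -> is_cv (fun n => Z (tn n) (xn n)) (Z t x)) ->
  (forall g t v, is_derive g t v ->
     is_derive (fun r => Z r (g r)) t (Zt t (g t) + Zx t (g t) * v)) ->
  (forall t x, is_derive (Z t) x (Zx t x)) ->
  (forall t x, is_derive (Zx t) x (Zxx t x)) ->
  barrier t0 (fun t x => P t * Q (Z t x))
    (fun t x => dP t * Q (Z t x) + P t * (dQ (Z t x) * Zt t x))
    (fun t x => P t * (dQ (Z t x) * Zx t x))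
    (fun t x => P t * (ddQ (Z t x) * (Zx t x * Zx t x) + dQ (Z t x) * Zxx t x)).
Proof.
  intros t0 f mu c Q dQ ddQ P dP Z Zt Zx Zxx HQ HP HdP HZc HZg HZx HZxx.
  assert (Ho := pf_ode _ _ _ _ _ _ HQ).
  constructor.
  - intros tn xn t x Ht Hx; apply is_cv_mult.
    + apply is_cv_comp; [apply (is_derive_continuous _ _ _ (HdP t)) | exact Ht].
    + apply (is_cv_comp Q (fun n => Z (tn n) (xn n)));
        [apply (po_Q_cont _ _ _ _ _ Ho) | apply HZc; assumption].
  - intros g t v Hg.
    assert (H := is_derive_mult_R P (fun r => Q (Z r (g r))) t _ _ (HdP t)
                   (is_derive_comp_R Q (fun r => Z r (g r)) t _ _ (po_Q _ _ _ _ _ Ho _) (HZg g t v Hg))).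
    replace (dP t * Q (Z t (g t)) + P t * (dQ (Z t (g t)) * Zt t (g t)) +
             P t * (dQ (Z t (g t)) * Zx t (g t)) * v)
      with (dP t * Q (Z t (g t)) + P t * (dQ (Z t (g t)) * (Zt t (g t) + Zx t (g t) * v)))
      by ring.
    exact H.
  - intros t x; apply (is_derive_scal (fun y => Q (Z t y))).
    apply (is_derive_comp_R Q (Z t)); [apply Ho | apply HZx].
  - intros t x Ht Hpos; apply (is_derive_scal (fun y => dQ (Z t y) * Zx t y)).
    assert (HZ : 0 < Z t x).
    { apply Rnot_le_lt; intros Hle.
      assert (Q (Z t x) <= Q 0).
      { apply (nondecreasing_of_derivative Q dQ); [exact Hle | | |]; intros.
        - apply Ho.
        - apply (po_Q_cont _ _ _ _ _ Ho).
        - left; apply HQ. }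
      rewrite (pf_zero _ _ _ _ _ _ HQ) in H; specialize (HP t Ht); nra. }
    replace (ddQ (Z t x) * (Zx t x * Zx t x) + dQ (Z t x) * Zxx t x)
      with (ddQ (Z t x) * Zx t x * Zx t x + dQ (Z t x) * Zxx t x) by ring.
    apply (is_derive_mult_R (fun y => dQ (Z t y)) (Zx t)); [| apply HZxx].
    apply (is_derive_comp_R dQ (Z t)); [apply Ho, HZ | apply HZx].
Qed.

Lemma profile_lt : forall f mu c Q dQ ddQ, profile f mu c Q dQ ddQ ->
  forall x y, x < y -> Q x < Q y.
Proof.
  intros f mu c Q dQ ddQ HQ x y Hxy.
  assert (Ho := pf_ode _ _ _ _ _ _ HQ).
  destruct (mean_value Q dQ x y Hxy) as [w [Hw H]];
    [intros; apply Ho | intros; apply (po_Q_cont _ _ _ _ _ Ho) |].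
  generalize (pf_incr _ _ _ _ _ _ HQ w); nra.
Qed.

Lemma profile_le : forall f mu c Q dQ ddQ, profile f mu c Q dQ ddQ ->
  forall x y, x <= y -> Q x <= Q y.
Proof.
  intros f mu c Q dQ ddQ HQ x y [Hxy | ->]; [left; apply (profile_lt _ _ _ _ _ _ HQ), Hxy | lra].
Qed.

(** * The solution does not exceed 1 *)

Definition tends_to_one (u : R -> R -> R) (h : R -> R) : Prop :=
  forall eps, 0 < eps -> exists A, 0 < A /\
    forall t x, x <= h t - A -> Rabs (u t x - 1) < eps.

Lemma exp_le_1 : forall x, x <= 0 -> exp x <= 1.
Proof.
  intros x [Hx | ->]; [| rewrite exp_0; lra].
  rewrite <- exp_0; left; apply exp_increasing, Hx.
Qed.

Lemma exp_decay_early : forall nu M eps t T,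
  0 < nu -> 0 < M -> 0 < eps ->
  exists t0, t0 <= t /\ t0 <= T /\ M * exp (- nu * (t - t0)) < eps.
Proof.
  intros nu M eps t T Hnu HM He.
  set (r := Rmax 0 (t - T) + M / (eps * nu)).
  assert (H0 : 0 < M / (eps * nu)) by (apply Rdiv_lt_0_compat; nra).
  assert (Hr : 0 < r /\ t - T <= r /\ M / (eps * nu) <= r).
  { unfold r; generalize (Rmax_l 0 (t - T)) (Rmax_r 0 (t - T)); lra. }
  exists (t - r); split; [lra | split; [lra |]].
  replace (t - (t - r)) with r by ring.
  assert (H1 : 1 + nu * r < exp (nu * r)) by (apply exp_ineq1; nra).
  assert (H2 : exp (- nu * r) * exp (nu * r) = 1).
  { rewrite <- exp_plus; replace (- nu * r + nu * r) with 0 by ring; apply exp_0. }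
  assert (H3 : M <= eps * (nu * r)).
  { replace M with (eps * nu * (M / (eps * nu))) at 1 by (field; lra).
    rewrite <- Rmult_assoc; apply Rmult_le_compat_l; nra. }
  generalize (exp_pos (- nu * r)); intros H4.
  assert (eps * (exp (- nu * r) * (1 + nu * r)) < eps * 1) by (apply Rmult_lt_compat_l; nra).
  nra.
Qed.

Lemma le_of_le_plus : forall a b, (forall eps, 0 < eps -> a <= b + eps) -> a <= b.
Proof.
  intros a b H; apply Rnot_lt_le; intros Hlt.
  specialize (H ((a - b) / 2) ltac:(lra)); lra.
Qed.

(** Where u exceeds 1 + eps the reaction is uniformly negative, so u lies below
    the spatially constant barrier 1 + eps + M exp(-nu (t - t0)) for every
    starting time t0. *)
Lemma solution_le_1 : forall f df mu u h ut ux uxx dh M,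
  reaction f df -> 0 < mu -> stefan f mu u h ut ux uxx dh ->
  tends_to_one u h -> 0 < M -> (forall t x, x <= h t -> u t x <= M) ->
  forall t x, x <= h t -> u t x <= 1.
Proof.
  intros f df mu u h ut ux uxx dh M Hf Hmu Hu Hfar HM HuM t x Hx.
  apply le_of_le_plus; intros eps He.
  destruct (continuity_ab_maj f (1 + eps) (1 + eps + M)) as [vm [Hvm Hvm']]; [lra | |].
  { intros v _; apply continuity_pt_filterlim, (is_derive_continuous f v (df v)), Hf. }
  assert (Hneg : f vm < 0) by (apply Hf; lra).
  set (nu := - f vm / (2 * M)).
  assert (Hnu : 0 < nu) by (apply Rdiv_lt_0_compat; lra).
  assert (HnuM : nu * M = - f vm / 2) by (unfold nu; field; lra).
  apply le_of_le_plus; intros eps' He'.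
  destruct (exp_decay_early nu M eps' t t Hnu HM He') as [t0 [Ht0 [_ Hexp]]].
  set (U := fun r (_ : R) => 1 + eps + M * exp (- nu * (r - t0))).
  destruct (Hfar eps He) as [A [HA HAu]].
  assert (Hhc : forall t, continuous h t)
    by (intros r; apply (is_derive_continuous h r (dh r)), Hu).
  assert (Hexp1 : forall r, t0 <= r -> exp (- nu * (r - t0)) <= 1).
  { intros r Hr; apply exp_le_1; nra. }
  assert (Hfar_u : forall r z, z <= h r - A -> 0 < 1 * (U r z - u r z)).
  { intros r z Hz; specialize (HAu r z Hz); apply Rabs_def2 in HAu.
    unfold U; generalize (exp_pos (- nu * (r - t0))); nra. }
  destruct (Rle_lt_dec x (h t - A)) as [Hxf | Hxn].
  { specialize (HAu t x Hxf); apply Rabs_def2 in HAu; lra. }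
  assert (H : 0 < 1 * (U t x - u t x)); [| unfold U in H; lra].
  apply (barrier_comparison 1 f mu u h ut ux uxx dh U
           (fun r _ => - nu * M * exp (- nu * (r - t0))) (fun _ _ => 0) (fun _ _ => 0)
           (fun r => h r - A) (fun r => h r + 1) t0 t); auto; try lra.
  - constructor.
    + intros tn xn r z Hr Hz; unfold U.
      apply (is_cv_comp (fun r => 1 + eps + M * exp (- nu * (r - t0)))); [| exact Hr].
      apply (ex_derive_continuous (K := R_AbsRing) (V := R_NormedModule)); auto_derive; trivial.
    + intros g r v _; unfold U; auto_derive; [trivial | unfold Rminus; ring].
    + intros r z; unfold U; apply (@is_derive_const R_AbsRing R_NormedModule).
    + intros r z _ _; apply (@is_derive_const R_AbsRing R_NormedModule).
  - intros r; apply continuous_minus_R; [auto | apply continuous_const].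
  - intros r; apply (continuous_plus h (fun _ => 1)); [auto | apply continuous_const].
  - intros r z Hr _ _ _.
    assert (HE := exp_pos (- nu * (r - t0))); assert (HE1 := Hexp1 r ltac:(lra)).
    assert (f (U r z) <= f vm) by (apply Hvm; unfold U; nra).
    nra.
  - intros r z _ _ _ HU0; exfalso; unfold U in HU0.
    generalize (exp_pos (- nu * (r - t0))); nra.
  - intros z _ Hz; unfold U; rewrite Rminus_diag, Rmult_0_r, exp_0.
    specialize (HuM t0 z Hz); lra.
  - intros r _ _; apply Hfar_u; lra.
  - intros r _ Hr; lra.
Qed.

(** * Stability of the semi-wave *)

(** Near 1 the reaction damps a relative perturbation e p of q at rate 2 beta;
    elsewhere it amplifies it at most linearly. *)
Lemma reaction_relative_perturbation : forall f df,
  reaction f df ->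
  exists p0 beta eta K, 0 < p0 <= 1 / 2 /\ 0 < beta /\ 0 < eta < 1 /\ 0 < K /\
    forall e p q, e = 1 \/ e = -1 -> 0 < p <= p0 -> 0 <= q <= 1 ->
      - (2 * K * p) <= e * ((1 + e * p) * f q - f ((1 + e * p) * q)) /\
      (1 - eta <= q ->
       2 * beta * p * q <= e * ((1 + e * p) * f q - f ((1 + e * p) * q))).
Proof.
  intros f df Hf.
  assert (H1 := re_stable _ _ Hf).
  set (beta := - df 1 / 4).
  assert (Hb : 0 < beta) by (unfold beta; lra).
  destruct (proj1 (continuous_R_eps df 1) (re_cont _ _ Hf 1) (2 * beta)) as [d0 [Hd0 Hd0']]; [lra |].
  set (d := Rmin d0 1).
  assert (Hd : 0 < d <= 1 /\ d <= d0).
  { unfold d; generalize (Rmin_l d0 1) (Rmin_r d0 1) (Rmin_glb_lt d0 1 0 Hd0 Rlt_0_1); lra. }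
  assert (Hdf : forall v, 1 - d < v < 1 + d -> df v <= - (2 * beta)).
  { intros v Hv; assert (Hv' : Rabs (v - 1) < d0) by (apply Rabs_def1; lra).
    specialize (Hd0' v Hv'); apply Rabs_def2 in Hd0'; unfold beta in *; lra. }
  destruct (C1_lipschitz f df 0 2) as [K [HK HKL]]; [lra | apply Hf | apply Hf |].
  assert (Hfc : forall v, continuous f v)
    by (intros v; apply (is_derive_continuous f v (df v)), Hf).
  exists (d / 2), beta, (d / 2), K.
  split; [lra |]; split; [exact Hb |]; split; [lra |]; split; [exact HK |].
  intros e p q He Hp Hq.
  assert (Hep : -1 <= e <= 1 /\ e * e = 1) by (destruct He as [-> | ->]; lra).
  assert (Hpq : 0 <= (1 + e * p) * q <= 2) by (destruct He as [-> | ->]; nra).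
  assert (Hsum : e * ((1 + e * p) * f q - f ((1 + e * p) * q)) =
                 p * f q - e * (f ((1 + e * p) * q) - f q))
    by (destruct He as [-> | ->]; ring).
  rewrite Hsum; split.
  - assert (A1 : Rabs (f q - f 0) <= K * Rabs (q - 0)) by (apply HKL; lra).
    assert (A2 : Rabs (f ((1 + e * p) * q) - f q) <= K * Rabs ((1 + e * p) * q - q))
      by (apply HKL; lra).
    rewrite (re_zero _ _ Hf), !Rminus_0_r, (Rabs_right q) in A1 by lra.
    replace ((1 + e * p) * q - q) with (e * (p * q)) in A2 by ring.
    rewrite Rabs_mult, (Rabs_right (p * q)) in A2 by nra.
    assert (He1 : Rabs e = 1).
    { destruct He as [-> | ->]; [apply Rabs_right; lra | rewrite Rabs_left; lra]. }
    rewrite He1 in A2.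
    apply Rabs_le_between in A1; apply Rabs_le_between in A2.
    assert (K * q <= K) by nra. assert (K * (1 * (p * q)) <= K * p) by nra.
    assert (- (K * p) <= p * f q) by nra.
    destruct He as [-> | ->]; lra.
  - intros Hq1.
    assert (B1 : 0 <= f q).
    { destruct (proj2 Hq) as [Hlt | ->]; [| rewrite (re_one _ _ Hf); lra].
      destruct (mean_value f df q 1 Hlt) as [w [Hw Hw']];
        [intros; apply Hf | intros; apply Hfc |].
      rewrite (re_one _ _ Hf) in Hw'; specialize (Hdf w ltac:(lra)); nra. }
    assert (B2 : 0 <= p * f q) by nra.
    assert (Hpq0 : 0 < p * q) by nra.
    destruct He as [-> | ->].
    + destruct (mean_value f df q ((1 + 1 * p) * q)) as [w [Hw Hw']];
        [nra | intros; apply Hf | intros; apply Hfc |].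
      rewrite Hw'; assert (Hdw : df w <= - (2 * beta)) by (apply Hdf; nra).
      replace ((1 + 1 * p) * q - q) with (p * q) by ring. nra.
    + destruct (mean_value f df ((1 + -1 * p) * q) q) as [w [Hw Hw']];
        [nra | intros; apply Hf | intros; apply Hfc |].
      assert (Hdw : df w <= - (2 * beta)) by (apply Hdf; nra).
      replace (q - (1 + -1 * p) * q) with (p * q) in Hw' by ring.
      assert (f ((1 + -1 * p) * q) - f q = - (df w * (p * q))) by lra.
      nra.
Qed.

Lemma continuous_positive_below : forall (g : R -> R) (a b : R),
  a <= b -> (forall x, continuous g x) -> (forall x, 0 < g x) ->
  exists k, 0 < k /\ forall x, a <= x <= b -> k <= g x.
Proof.
  intros g a b Hab Hc Hp.
  destruct (continuity_ab_min g a b Hab) as [m [Hm _]].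
  - intros x _; apply continuity_pt_filterlim, Hc.
  - exists (g m); split; [apply Hp | exact Hm].
Qed.

(** The sign e = 1 stands for ordering from above and e = -1 for ordering from
    below, so that both directions share their proofs. In either case the
    relative error p decays, at the price of a shift of size sigma p. *)
Definition stable_semi_wave (c : R) (Q : R -> R) (u : R -> R -> R) (h : R -> R)
    (p0 beta sigma : R) : Prop :=
  forall e p xi t0, e = 1 \/ e = -1 -> 0 < p <= p0 ->
    (forall x, x <= h t0 -> 0 <= e * ((1 + e * p) * Q (c * t0 + xi - x) - u t0 x)) ->
    forall t x, t0 <= t -> x <= h t ->
      0 <= e * ((1 + e * p * exp (- beta * (t - t0))) * Q (c * t + xi + e * (sigma * p) - x)
                - u t x).

(** The Fife-McLeod barriers (1 + e p exp(-beta t)) Q(c t + shift - x): the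
    drift of the shift, of size sigma p in total and of sign e, pays for the
    perturbation where Q' is bounded below, and the stability of 1 pays for it
    where Q is close to 1. *)
Lemma semi_wave_stability : forall f df mu c Q dQ ddQ u h ut ux uxx dh,
  reaction f df -> 0 < mu -> profile f mu c Q dQ ddQ ->
  stefan f mu u h ut ux uxx dh -> tends_to_one u h ->
  (forall t x, x <= h t -> u t x <= 1) ->
  exists p0 beta sigma, 0 < p0 <= 1 / 2 /\ 0 < beta /\ 0 < sigma /\
    stable_semi_wave c Q u h p0 beta sigma.
Proof.
  intros f df mu c Q dQ ddQ u h ut ux uxx dh Hf Hmu HQ Hu Hfar Hu1.
  destruct (reaction_relative_perturbation f df Hf)
    as [p0 [beta [eta [K [Hp0 [Hbeta [Heta [HK HNL]]]]]]]].
  assert (Ho := pf_ode _ _ _ _ _ _ HQ).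
  assert (Hlt := profile_lt _ _ _ _ _ _ HQ).
  destruct (pf_lim _ _ _ _ _ _ HQ eta) as [Z0 HZ0]; [lra |].
  destruct (continuous_positive_below dQ 0 (Rmax 0 Z0)) as [k [Hk HkQ]];
    [apply Rmax_l | apply Ho | apply HQ |].
  set (s' := 2 * (beta + 2 * K + 1) / k + c).
  assert (Hc := pf_speed _ _ _ _ _ _ HQ).
  assert (Hs'0 : 0 < 2 * (beta + 2 * K + 1) / k) by (apply Rdiv_lt_0_compat; lra).
  assert (Hs' : c < s') by (unfold s'; lra).
  assert (Hs'k : 2 * (beta + 2 * K + 1) <= s' * k).
  { unfold s'; rewrite Rmult_plus_distr_r.
    replace (2 * (beta + 2 * K + 1) / k * k) with (2 * (beta + 2 * K + 1)) by (field; lra).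
    nra. }
  set (sigma := s' / beta).
  assert (Hsigma : 0 < sigma) by (apply Rdiv_lt_0_compat; lra).
  exists p0, beta, sigma; split; [exact Hp0 |]; split; [exact Hbeta |].
  split; [exact Hsigma |]; intros e p xi t0 He Hp Hini t x Ht Hx.
  assert (Hhc : forall t, continuous h t)
    by (intros r; apply (is_derive_continuous h r (dh r)), Hu).
  set (ex := fun r => exp (- beta * (r - t0))).
  assert (Hex0 : forall r, 0 < ex r) by (intros r; apply exp_pos).
  assert (Hex1 : forall r, t0 <= r -> ex r <= 1).
  { intros r Hr; apply exp_le_1; nra. }
  assert (Hext : forall r, r <= t -> ex t <= ex r).
  { intros r Hr; unfold ex; apply Rnot_lt_le; intros Hl; apply exp_lt_inv in Hl; nra. }
  assert (Hdex : forall r, is_derive ex r (- beta * ex r)).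
  { intros r; unfold ex; auto_derive; [trivial | unfold Rminus; ring]. }
  set (P := fun r => 1 + e * p * ex r).
  assert (HP1 : forall r, t0 <= r -> 1 / 2 <= P r <= 2).
  { intros r Hr; specialize (Hex1 r Hr); specialize (Hex0 r); unfold P.
    destruct He as [-> | ->]; nra. }
  (* an extra shift by eps makes the initial ordering strict, as the comparison
     lemma requires *)
  assert (Hstrict : forall eps, 0 < eps ->
    0 <= e * (P t * Q (c * t + xi + e * (sigma * p) + e * eps - x) - u t x)).
  { intros eps Heps.
    set (Z := fun r y => c * r + xi + e * eps + e * (sigma * p) * (1 - ex r) - y).
    (* far from the front the barrier and the solution are apart *)
    assert (Hleft : exists lo, (forall r, continuous lo r) /\
      forall r y, t0 <= r <= t -> y <= lo r -> y <= h r -> 0 < e * (P r * Q (Z r y) - u r y)).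
    { set (pm := p * ex t).
      assert (Hpm : 0 < pm) by (apply Rmult_lt_0_compat; [lra | apply Hex0]).
      assert (Hpmr : forall r, r <= t -> pm <= p * ex r)
        by (intros r Hr; apply Rmult_le_compat_l; [lra | apply Hext, Hr]).
      destruct He as [-> | ->].
      - destruct (pf_lim _ _ _ _ _ _ HQ (pm / (1 + pm))) as [Zb HZb].
        { apply Rdiv_lt_0_compat; lra. }
        exists (fun r => Z r (Zb + 1)); split.
        + intros r; unfold Z; apply (is_derive_continuous _ r (c + sigma * p * (beta * ex r))).
          assert (H := Hdex r); auto_derive; [exists (- beta * ex r); exact H |].
          subst_derive H; ring.
        + intros r y Hr Hy Hyh.
          assert (HZy : Zb < Z r y) by (unfold Z in *; lra).
          specialize (HZb _ HZy); specialize (Hpmr r (proj2 Hr)).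
          specialize (Hu1 r y Hyh).
          assert (E1 : (1 + pm) * (1 - pm / (1 + pm)) = 1) by (field; lra).
          assert (E2 : 1 < (1 + pm) * Q (Z r y)) by nra.
          assert (E3 : 0 < Q (Z r y)) by nra.
          unfold P; nra.
      - destruct (Hfar pm Hpm) as [A [HA HAu]].
        exists (fun r => h r - A); split.
        + intros r; apply continuous_minus_R; [auto | apply continuous_const].
        + intros r y Hr Hy Hyh; specialize (HAu r y Hy); apply Rabs_def2 in HAu.
          specialize (Hpmr r (proj2 Hr)).
          assert (HPr := HP1 r (proj1 Hr)).
          assert (P r * Q (Z r y) <= P r)
            by (generalize (pf_lt1 _ _ _ _ _ _ HQ (Z r y)); nra).
          unfold P in *; lra. }
    destruct Hleft as [lo [Hloc Hlo]].
    assert (H : 0 < e * (P t * Q (Z t x) - u t x)).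
    { destruct (Rle_lt_dec x (lo t)) as [Hxl | Hxl]; [apply Hlo; auto; lra |].
      set (Zt := fun r (_ : R) => c + e * (sigma * p) * (beta * ex r)).
      assert (Hbar := profile_barrier t0 f mu c Q dQ ddQ P (fun r => e * p * (- beta * ex r))
                Z Zt (fun _ _ => -1) (fun _ _ => 0) HQ).
      match type of Hbar with _ -> _ -> _ -> _ -> _ -> _ -> ?goal => assert (Hb : goal) end.
      { apply Hbar.
        - intros r Hr; specialize (HP1 r ltac:(lra)); lra.
        - intros r; unfold P; assert (H := Hdex r).
          auto_derive; [exists (- beta * ex r); exact H | subst_derive H; ring].
        - intros tn xn r y Hr Hy; unfold Z.
          apply is_cv_minus; [| exact Hy].
          apply (is_cv_comp (fun r => c * r + xi + e * eps + e * (sigma * p) * (1 - ex r)));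
            [| exact Hr].
          assert (H := Hdex r).
          apply (is_derive_continuous _ r (c + e * (sigma * p) * (beta * ex r))).
          auto_derive; [exists (- beta * ex r); exact H | subst_derive H; ring].
        - intros g r v Hg; unfold Z, Zt; assert (H := Hdex r).
          auto_derive.
          + split; [exists (- beta * ex r); exact H | split; [exists v; exact Hg | trivial]].
          + subst_derive H; subst_derive Hg; ring.
        - intros r y; unfold Z; auto_derive; [trivial | ring].
        - intros r y; apply (@is_derive_const R_AbsRing R_NormedModule). }
      clear Hbar.
      assert (Hdrift : forall r, e * (sigma * p) * (beta * ex r) = e * s' * (p * ex r)).
      { intros r; unfold sigma; field; lra. }
      assert (Hpe : forall r, t0 <= r -> 0 < p * ex r <= p0).
      { intros r Hr; specialize (Hex0 r); specialize (Hex1 r Hr); nra. }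
      apply (barrier_comparison e f mu u h ut ux uxx dh _ _ _ _ lo (fun r => h r + 1) t0 t
               He Hmu Hu Hb); auto; try lra.
      - intros r; apply (continuous_plus h (fun _ => 1)); [auto | apply continuous_const].
      - intros r y Hr Hy Hyh HUu.
        assert (HPr := HP1 r ltac:(lra)); assert (Hper := Hpe r ltac:(lra)).
        assert (HQpos : 0 < Q (Z r y)).
        { generalize (st_pos _ _ _ _ _ _ _ _ Hu r y Hyh); rewrite <- HUu; nra. }
        assert (HZpos : 0 < Z r y).
        { apply Rnot_le_lt; intros Hle; generalize (profile_le _ _ _ _ _ _ HQ _ _ Hle).
          rewrite (pf_zero _ _ _ _ _ _ HQ); lra. }
        assert (HQ1 := pf_lt1 _ _ _ _ _ _ HQ (Z r y)).
        destruct (HNL e (p * ex r) (Q (Z r y)) He Hper ltac:(lra)) as [N1 N2].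
        assert (Hdq := pf_incr _ _ _ _ _ _ HQ (Z r y)).
        unfold Zt; rewrite Hdrift, (po_eq _ _ _ _ _ Ho _ HZpos).
        set (q := Q (Z r y)) in *; set (dq := dQ (Z r y)) in *.
        unfold P in HPr |- *.
        replace (e * p * ex r) with (e * (p * ex r)) in * by ring.
        set (pr := p * ex r) in *.
        replace (e * (e * p * (- beta * ex r) * q + (1 + e * pr) * (dq * (c + e * s' * pr)) -
                 (1 + e * pr) * ((c * dq - f q) * (-1 * -1) + dq * 0) - f ((1 + e * pr) * q)))
          with (e * e * (- beta * pr * q) + e * e * (1 + e * pr) * s' * (pr * dq) +
                e * ((1 + e * pr) * f q - f ((1 + e * pr) * q))) by (unfold pr; ring).
        assert (Hee : e * e = 1) by (destruct He as [-> | ->]; ring).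
        rewrite Hee.
        assert (Hpq : 0 < pr * q) by (apply Rmult_lt_0_compat; lra).
        assert (Hpd : 0 < pr * dq) by (apply Rmult_lt_0_compat; lra).
        destruct (Rle_lt_dec (1 - eta) q) as [Hq | Hq].
        + specialize (N2 Hq).
          assert (0 <= (1 + e * pr) * (s' * (pr * dq)))
            by (apply Rmult_le_pos; [lra | apply Rmult_le_pos; lra]).
          assert (0 < beta * (pr * q)) by (apply Rmult_lt_0_compat; lra). lra.
        + assert (HZm : 0 <= Z r y <= Rmax 0 Z0).
          { split; [lra |]; apply Rle_trans with (2 := Rmax_r _ _).
            apply Rnot_lt_le; intros Hl; specialize (HZ0 _ Hl); fold q in HZ0; lra. }
          specialize (HkQ _ HZm); fold dq in HkQ.
          assert (M0 : s' * k <= s' * dq) by (apply Rmult_le_compat_l; lra).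
          assert (M1 : pr * (2 * (beta + 2 * K + 1)) <= pr * (s' * dq))
            by (apply Rmult_le_compat_l; lra).
          assert (M2 : 1 / 2 * (s' * (pr * dq)) <= (1 + e * pr) * (s' * (pr * dq)))
            by (apply Rmult_le_compat_r; [apply Rmult_le_pos; lra | lra]).
          assert (M3 : beta * (pr * q) <= beta * pr)
            by (apply Rmult_le_compat_l; [lra | rewrite <- (Rmult_1_r pr) at 2;
                apply Rmult_le_compat_l; lra]).
          lra.
      - intros r y Hr Hy Hyh HU0.
        assert (HPr := HP1 r ltac:(lra)); assert (Hper := Hpe r ltac:(lra)).
        assert (HQ0 : Q (Z r y) = 0) by nra.
        assert (HZr : Z r y = 0).
        { rewrite <- (pf_zero _ _ _ _ _ _ HQ) in HQ0.
          destruct (Rtotal_order (Z r y) 0) as [Hl | [H | Hl]]; [| exact H |];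
            apply Hlt in Hl; lra. }
        assert (Hdq := pf_incr _ _ _ _ _ _ HQ 0).
        unfold Zt; rewrite Hdrift, HQ0, HZr; split; [nra |].
        assert (Hsl := pf_slope _ _ _ _ _ _ HQ).
        unfold P in HPr |- *; replace (e * p * ex r) with (e * (p * ex r)) in * by ring.
        set (pr := p * ex r) in *; set (dq := dQ 0) in *.
        replace (e * (e * p * (- beta * ex r) * 0 + (1 + e * pr) * (dq * (c + e * s' * pr)) -
                 mu * ((1 + e * pr) * (dq * -1) * ((1 + e * pr) * (dq * -1)))))
          with ((1 + e * pr) * dq * (e * (c - mu * dq) + e * e * (s' - mu * dq) * pr)) by ring.
        rewrite <- Hsl.
        assert (Hee : e * e = 1) by (destruct He as [-> | ->]; ring).
        rewrite Hee, Rminus_diag, Rmult_0_r, Rplus_0_l, Rmult_1_l.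
        apply Rmult_lt_0_compat; apply Rmult_lt_0_compat; lra.
      - intros y _ Hyh; specialize (Hini y Hyh).
        assert (Hex00 : ex t0 = 1)
          by (unfold ex; rewrite Rminus_diag, Rmult_0_r; apply exp_0).
        assert (HPt := HP1 t0 (Rle_refl _)).
        unfold Z; rewrite Hex00, Rminus_diag, Rmult_0_r, Rplus_0_r.
        unfold P in *; rewrite Hex00, Rmult_1_r in *.
        assert (Hsh : 0 < e * (Q (c * t0 + xi + e * eps - y) - Q (c * t0 + xi - y))).
        { destruct He as [-> | ->];
            [assert (H := Hlt (c * t0 + xi - y) (c * t0 + xi + 1 * eps - y) ltac:(lra))
            | assert (H := Hlt (c * t0 + xi + -1 * eps - y) (c * t0 + xi - y) ltac:(lra))]; lra. }
        nra.
      - intros r Hr Hlh; apply Hlo; lra.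
      - intros r Hr Hlh; lra. }
    assert (HPt := HP1 t Ht).
    assert (Hmon : 0 <= e * (Q (c * t + xi + e * (sigma * p) + e * eps - x) - Q (Z t x))).
    { assert (0 < sigma * p * ex t) by (specialize (Hex0 t); apply Rmult_lt_0_compat; nra).
      unfold Z; destruct He as [-> | ->].
      - assert (G := profile_le _ _ _ _ _ _ HQ
          (c * t + xi + 1 * eps + 1 * (sigma * p) * (1 - ex t) - x)
          (c * t + xi + 1 * (sigma * p) + 1 * eps - x) ltac:(lra)); lra.
      - assert (G := profile_le _ _ _ _ _ _ HQ
          (c * t + xi + -1 * (sigma * p) + -1 * eps - x)
          (c * t + xi + -1 * eps + -1 * (sigma * p) * (1 - ex t) - x) ltac:(lra)); lra. }
    nra. }
  set (g := fun r => e * (P t * Q (c * t + xi + e * (sigma * p) + e * (- r) - x) - u t x)).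
  assert (Hg : 0 <= g 0).
  { apply (continuous_nonneg_left g 0 1); [| lra | intros r Hr; apply Hstrict; lra].
    apply (ex_derive_continuous (K := R_AbsRing) (V := R_NormedModule)); unfold g.
    auto_derive; eexists; apply Ho. }
  unfold g in Hg; rewrite Ropp_0, Rmult_0_r, Rplus_0_r in Hg; exact Hg.
Qed.

(** For an entire solution the starting time can be sent to minus infinity, so
    that the decaying error disappears and only the additional shift is left. *)
Lemma entire_ordering : forall f mu c Q dQ ddQ u h p0 beta sigma e p xi,
  profile f mu c Q dQ ddQ -> 0 < beta ->
  stable_semi_wave c Q u h p0 beta sigma ->
  e = 1 \/ e = -1 -> 0 < p <= p0 ->
  (forall T, exists t0, t0 <= T /\
     forall x, x <= h t0 -> 0 <= e * ((1 + e * p) * Q (c * t0 + xi - x) - u t0 x)) ->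
  forall t x, x <= h t -> 0 <= e * (Q (c * t + xi + e * (sigma * p) - x) - u t x).
Proof.
  intros f mu c Q dQ ddQ u h p0 beta sigma e p xi HQ Hbeta Hst He Hp Hord t x Hx.
  apply le_of_le_plus; intros eps Heps.
  destruct (exp_decay_early beta p eps t t Hbeta (proj1 Hp) Heps) as [T [HT [_ HE]]].
  destruct (Hord T) as [t0 [Ht0 Hini]].
  assert (H := Hst e p xi t0 He Hp Hini t x ltac:(lra) Hx).
  assert (HE0 : p * exp (- beta * (t - t0)) <= p * exp (- beta * (t - T))).
  { apply Rmult_le_compat_l; [lra |]; apply Rnot_lt_le; intros Hl.
    apply exp_lt_inv in Hl; nra. }
  assert (HQ1 := pf_lt1 _ _ _ _ _ _ HQ (c * t + xi + e * (sigma * p) - x)).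
  set (q := Q (c * t + xi + e * (sigma * p) - x)) in *.
  set (E := p * exp (- beta * (t - t0))) in *.
  assert (HEp : 0 < E) by (apply Rmult_lt_0_compat; [lra | apply exp_pos]).
  replace (e * p * exp (- beta * (t - t0))) with (e * E) in H by (unfold E; ring).
  assert (Hee : e * e = 1) by (destruct He as [-> | ->]; ring).
  replace (e * ((1 + e * E) * q - u t x)) with (e * (q - u t x) + e * e * (E * q)) in H by ring.
  rewrite Hee in H. assert (E * q <= E * 1) by (apply Rmult_le_compat_l; lra). lra.
Qed.

Lemma solution_nonneg : forall f mu u h ut ux uxx dh, stefan f mu u h ut ux uxx dh ->
  forall t x, x <= h t -> 0 <= u t x.
Proof.
  intros f mu u h ut ux uxx dh Hu t x [Hx | ->]; [left; apply Hu, Hx |].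
  rewrite (st_zero _ _ _ _ _ _ _ _ Hu); lra.
Qed.

(** The front h(t) - c t stays within bounded distance of each earlier
    position, uniformly, so it is bounded as t tends to minus infinity. *)
Lemma solution_between_shifts : forall f mu c Q dQ ddQ u h ut ux uxx dh p0 beta sigma,
  profile f mu c Q dQ ddQ -> stefan f mu u h ut ux uxx dh -> tends_to_one u h ->
  (forall t x, x <= h t -> u t x <= 1) ->
  0 < p0 <= 1 / 2 -> 0 < beta -> 0 < sigma -> stable_semi_wave c Q u h p0 beta sigma ->
  forall e, e = 1 \/ e = -1 ->
  exists xi, forall t x, x <= h t -> 0 <= e * (Q (c * t + xi - x) - u t x).
Proof.
  intros f mu c Q dQ ddQ u h ut ux uxx dh p0 beta sigma HQ Hu Hfar Hu1 Hp0 Hbeta Hsigma Hst.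
  assert (Hu0 := solution_nonneg _ _ _ _ _ _ _ _ Hu).
  assert (Hmon := profile_le _ _ _ _ _ _ HQ). assert (Hlt := profile_lt _ _ _ _ _ _ HQ).
  assert (HQ0 := pf_zero _ _ _ _ _ _ HQ).
  destruct (pf_lim _ _ _ _ _ _ HQ (p0 / (1 + p0))) as [X0 HX0].
  { apply Rdiv_lt_0_compat; lra. }
  set (X := X0 + 1).
  assert (HX : 1 <= (1 + p0) * Q X).
  { specialize (HX0 X ltac:(unfold X; lra)).
    assert ((1 + p0) * (1 - p0 / (1 + p0)) = 1) by (field; lra). nra. }
  destruct (Hfar p0) as [A [HA HAu]]; [lra |].
  assert (Hup : forall t0 x, x <= h t0 -> u t0 x <= (1 + p0) * Q (h t0 + X - x)).
  { intros t0 x Hx; specialize (Hu1 t0 x Hx).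
    specialize (Hmon X (h t0 + X - x) ltac:(lra)); nra. }
  assert (Hdown : forall t0 x, x <= h t0 -> (1 - p0) * Q (h t0 - A - x) <= u t0 x).
  { intros t0 x Hx; destruct (Rle_lt_dec x (h t0 - A)) as [Hxa | Hxa].
    - specialize (HAu t0 x Hxa); apply Rabs_def2 in HAu.
      generalize (pf_lt1 _ _ _ _ _ _ HQ (h t0 - A - x)); nra.
    - specialize (Hu0 t0 x Hx); specialize (Hmon (h t0 - A - x) 0 ltac:(lra)); nra. }
  assert (Hex : forall t0, t0 <= 0 -> 0 < exp (- beta * (0 - t0)) <= 1).
  { intros t0 Ht0; split; [apply exp_pos | apply exp_le_1; nra]. }
  set (S := sigma * p0).
  assert (Hback1 : forall t0, t0 <= 0 -> h 0 <= h t0 - c * t0 + X + S).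
  { intros t0 Ht0.
    assert (Hini : forall x, x <= h t0 ->
              0 <= 1 * ((1 + 1 * p0) * Q (c * t0 + (h t0 - c * t0 + X) - x) - u t0 x)).
    { intros x Hx; specialize (Hup t0 x Hx).
      replace (c * t0 + (h t0 - c * t0 + X) - x) with (h t0 + X - x) by ring. lra. }
    assert (H := Hst 1 p0 _ t0 (or_introl eq_refl) ltac:(lra) Hini 0 (h 0) Ht0 (Rle_refl _)).
    rewrite (st_zero _ _ _ _ _ _ _ _ Hu) in H; specialize (Hex t0 Ht0).
    apply Rnot_lt_le; intros Hl.
    assert (Hneg := Hlt (c * 0 + (h t0 - c * t0 + X) + 1 * (sigma * p0) - h 0) 0
                      ltac:(unfold S in Hl; lra)).
    rewrite HQ0 in Hneg; rewrite Rmult_1_l, Rmult_1_l, Rminus_0_r in H.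
    set (E := exp (- beta * (0 - t0))) in *.
    assert (0 < 1 + p0 * E) by nra. nra. }
  assert (Hback2 : forall t0, t0 <= 0 -> h t0 - c * t0 - A - S <= h 0).
  { intros t0 Ht0.
    assert (Hini : forall x, x <= h t0 ->
              0 <= -1 * ((1 + -1 * p0) * Q (c * t0 + (h t0 - c * t0 - A) - x) - u t0 x)).
    { intros x Hx; specialize (Hdown t0 x Hx).
      replace (c * t0 + (h t0 - c * t0 - A) - x) with (h t0 - A - x) by ring. lra. }
    assert (H := Hst (-1) p0 _ t0 (or_intror eq_refl) ltac:(lra) Hini 0 (h 0) Ht0 (Rle_refl _)).
    rewrite (st_zero _ _ _ _ _ _ _ _ Hu) in H; specialize (Hex t0 Ht0).
    apply Rnot_lt_le; intros Hl.
    assert (Hneg := Hlt 0 (c * 0 + (h t0 - c * t0 - A) + -1 * (sigma * p0) - h 0)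
                      ltac:(unfold S in Hl; lra)).
    rewrite HQ0 in Hneg; set (E := exp (- beta * (0 - t0))) in *.
    assert (0 < 1 + -1 * p0 * E) by nra. nra. }
  intros e [-> | ->].
  - exists (h 0 + A + S + X + 1 * (sigma * p0)); intros t x Hx.
    assert (H := entire_ordering f mu c Q dQ ddQ u h p0 beta sigma 1 p0 (h 0 + A + S + X)
                   HQ Hbeta Hst (or_introl eq_refl) ltac:(lra)).
    rewrite <- Rplus_assoc; apply H; [| exact Hx].
    intros T; exists (Rmin T 0); split; [apply Rmin_l |].
    assert (HT := Rmin_r T 0); set (t0 := Rmin T 0) in *.
    intros y Hy; specialize (Hup t0 y Hy); specialize (Hback2 t0 HT).
    specialize (Hmon (h t0 + X - y) (c * t0 + (h 0 + A + S + X) - y) ltac:(lra)). nra.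
  - exists (h 0 - X - S - A + -1 * (sigma * p0)); intros t x Hx.
    assert (H := entire_ordering f mu c Q dQ ddQ u h p0 beta sigma (-1) p0 (h 0 - X - S - A)
                   HQ Hbeta Hst (or_intror eq_refl) ltac:(lra)).
    rewrite <- Rplus_assoc; apply H; [| exact Hx].
    intros T; exists (Rmin T 0); split; [apply Rmin_l |].
    assert (HT := Rmin_r T 0); set (t0 := Rmin T 0) in *.
    intros y Hy; specialize (Hdown t0 y Hy); specialize (Hback1 t0 HT).
    specialize (Hmon (c * t0 + (h 0 - X - S - A) - y) (h t0 - A - y) ltac:(lra)). nra.
Qed.

(** * A one-sided Lipschitz bound *)

(** Doubling the space variable: u(t,x) - u(t,y) cannot touch the concave
    barrier N (2 r - r^2), r = x - y, from below, since the second derivatives in x and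
    in y together would exceed the oscillation of f(u). On the free boundary
    u(t,x) = 0 and there is nothing to prove, which is why only this one-sided
    bound comes for free. *)
Lemma solution_one_sided_lipschitz : forall f df mu u h ut ux uxx dh,
  reaction f df -> stefan f mu u h ut ux uxx dh -> tends_to_one u h ->
  (forall t x, x <= h t -> u t x <= 1) ->
  exists N, 0 < N /\ forall t x y, y <= x <= h t -> x - y <= 1 ->
    u t x - u t y <= N * (x - y).
Proof.
  intros f df mu u h ut ux uxx dh Hf Hu Hfar Hu1.
  assert (Hu0 := solution_nonneg _ _ _ _ _ _ _ _ Hu).
  destruct (continuous_bounded f 0 1) as [F [HF HFb]]; [lra | |].
  { intros v _; apply (is_derive_continuous f v (df v)), Hf. }
  set (N := F + 1).
  exists (2 * N); split; [unfold N; lra |].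
  intros t1 x1 y1 Hxy1 Hr1.
  apply le_of_le_plus; intros eps Heps.
  destruct (exp_decay_early 1 2 eps t1 t1 Rlt_0_1 ltac:(lra) Heps) as [t0 [Ht01 [_ HE]]].
  assert (Hhc : forall t, continuous h t)
    by (intros r; apply (is_derive_continuous h r (dh r)), Hu).
  set (ex := fun r => exp (- (1) * (r - t0))).
  assert (Hex0 : forall r, 0 < ex r) by (intros r; apply exp_pos).
  assert (Hex1 : forall r, t0 <= r -> ex r <= 1).
  { intros r Hr; apply exp_le_1; lra. }
  assert (Hext : forall r, r <= t1 -> ex t1 <= ex r).
  { intros r Hr; unfold ex; apply Rnot_lt_le; intros Hl; apply exp_lt_inv in Hl; lra. }
  assert (Hdex : forall r, is_derive ex r (- ex r)).
  { intros r; unfold ex; auto_derive; [trivial | unfold Rminus; ring]. }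
  set (w := fun r x y => N * (2 * (x - y) - (x - y) * (x - y)) + 2 * ex r - (u r x - u r y)).
  destruct (Hfar (ex t1 / 2)) as [A [HA HAu]]; [specialize (Hex0 t1); lra |].
  assert (Hphi : forall r, 0 <= r <= 1 -> 0 <= N * (2 * r - r * r)).
  { intros r Hr; apply Rmult_le_pos; [unfold N; lra | nra]. }
  assert (Hwfar : forall r x y, r <= t1 -> x <= h r - A -> y <= x -> x - y <= 1 -> 0 < w r x y).
  { intros r x y Hr Hx Hyx Hxy; unfold w.
    assert (A1 := HAu r x Hx); assert (A2 := HAu r y ltac:(lra)).
    apply Rabs_def2 in A1; apply Rabs_def2 in A2.
    specialize (Hphi (x - y) ltac:(lra)); specialize (Hext r Hr); specialize (Hex0 t1); lra. }
  assert (Hw : 0 < w t1 x1 y1).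
  { apply Rnot_le_lt; intros Hbad.
    destruct (continuous_bounded h t0 t1) as [M1 [HM1 HB1]]; [lra | auto |].
    set (M := M1 + A + 1 + Rabs t0 + Rabs t1).
    set (B := fun t x y => t0 <= t <= t1 /\ h t - A <= x /\ x <= h t /\ x - 1 <= y /\ y <= x /\
                w t x y <= 0).
    destruct (earliest_point B (- M) M) as [t [x [y [HBt Hfirst]]]].
    { intros t x y [Ht [Hx1 [Hx2 [Hy1 [Hy2 _]]]]].
      specialize (HB1 t Ht); apply Rabs_le_between in HB1.
      generalize (Rle_abs t0) (Rle_abs (- t1)); rewrite (Rabs_Ropp t1).
      generalize (Rabs_pos t0) (Rabs_pos t1) (Rle_abs t1) (Rle_abs (- t0)).
      rewrite (Rabs_Ropp t0); unfold M; intros; repeat split; lra. }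
    { intros tn xn yn t x y HB Ht Hx Hy; unfold B in HB |- *.
      assert (Hh : is_cv (fun n => h (tn n)) (h t)) by (apply is_cv_comp; auto).
      assert (Hxm : is_cv (fun n => xn n - 1) (x - 1)) by (apply is_cv_minus; [exact Hx | apply is_cv_const]).
      split; [split |].
      - apply (is_cv_le (fun _ => t0) tn); [intros n; apply HB | apply is_cv_const | exact Ht].
      - apply (is_cv_le tn (fun _ => t1)); [intros n; apply HB | exact Ht | apply is_cv_const].
      - split; [| split; [| split; [| split]]].
        + apply (is_cv_le (fun n => h (tn n) - A) xn); [intros n; apply HB | | exact Hx].
          apply is_cv_minus; [exact Hh | apply is_cv_const].
        + apply (is_cv_le xn (fun n => h (tn n))); [intros n; apply HB | exact Hx | exact Hh].
        + apply (is_cv_le (fun n => xn n - 1) yn); [intros n; apply HB | exact Hxm | exact Hy].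
        + apply (is_cv_le yn xn); [intros n; apply HB | exact Hy | exact Hx].
        + apply (is_cv_le (fun n => w (tn n) (xn n) (yn n)) (fun _ => 0));
            [intros n; apply HB | | apply is_cv_const].
          unfold w; apply is_cv_minus.
          * assert (Hd : is_cv (fun n => xn n - yn n) (x - y)) by (apply is_cv_minus; assumption).
            assert (Hp : is_cv (fun n => N * (2 * (xn n - yn n) - (xn n - yn n) * (xn n - yn n)))
                           (N * (2 * (x - y) - (x - y) * (x - y)))).
            { apply is_cv_mult; [apply is_cv_const |]; apply is_cv_minus;
                apply is_cv_mult; try exact Hd; apply is_cv_const. }
            apply is_lim_seq_plus'; [exact Hp |].
            apply is_cv_mult; [apply is_cv_const |].
            apply is_cv_comp; [apply (is_derive_continuous _ _ _ (Hdex t)) | exact Ht].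
          * apply is_cv_minus; apply (st_cont _ _ _ _ _ _ _ _ Hu); try assumption.
            -- intros n; apply HB.
            -- intros n; apply Rle_trans with (xn n); apply HB. }
    { exists t1, x1, y1; unfold B.
      destruct (Rle_lt_dec x1 (h t1 - A)) as [Hxl | Hxl].
      - specialize (Hwfar t1 x1 y1 (Rle_refl _) Hxl ltac:(lra) Hr1); lra.
      - repeat split; lra. }
    destruct HBt as [Ht [Hx1 [Hx2 [Hy1 [Hy2 Hwt]]]]].
    assert (Hbefore : forall r z z', t0 <= r < t -> h r - A <= z <= h r -> z - 1 <= z' <= z ->
              0 < w r z z').
    { intros r z z' Hr Hz Hz'; apply Rnot_le_lt; intros Hle.
      assert (t <= r); [| lra]. apply (Hfirst r z z'); unfold B; repeat split; lra. }
    assert (Hphixy := Hphi (x - y) ltac:(lra)).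
    assert (Hext' := Hex0 t).
    assert (HN : 1 <= N) by (unfold N; lra).
    assert (Hxh : x < h t).
    { destruct Hx2 as [| ->]; [assumption |].
      unfold w in Hwt; rewrite (st_zero _ _ _ _ _ _ _ _ Hu) in Hwt.
      specialize (Hu0 t y ltac:(lra)); lra. }
    assert (Hyx : y < x).
    { destruct Hy2 as [| ->]; [assumption | unfold w in Hwt; lra]. }
    assert (Hyx1 : x - 1 < y).
    { destruct Hy1 as [| <-]; [assumption |]; unfold w in Hwt.
      specialize (Hu1 t x ltac:(lra)); specialize (Hu0 t (x - 1) ltac:(lra)).
      replace (x - (x - 1)) with 1 in Hwt by ring. lra. }
    assert (HxA : h t - A < x).
    { apply Rnot_le_lt; intros Hle.
      specialize (Hwfar t x y ltac:(lra) Hle ltac:(lra) ltac:(lra)); lra. }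
    assert (Ht0 : t0 < t).
    { destruct (proj1 Ht) as [| <-]; [assumption |]; unfold w in Hwt.
      specialize (Hu1 t0 x ltac:(lra)); specialize (Hu0 t0 y ltac:(lra)).
      unfold ex in Hwt; rewrite Rminus_diag, Rmult_0_r, exp_0 in Hwt; lra. }
    assert (Hearlier : forall z z', h t - A < z < h t -> z - 1 <= z' <= z ->
              exists d, 0 < d /\ forall r, t - d < r < t -> 0 < w r z z').
    { intros z z' Hz Hz'.
      destruct (near_of_continuous (fun r => h r - z) t) as [d1 [Hd1 H1]];
        [apply continuous_minus_R; [auto | apply continuous_const] | lra |].
      destruct (near_of_continuous (fun r => z - (h r - A)) t) as [d2 [Hd2 H2]];
        [repeat apply continuous_minus_R; try apply continuous_const; auto | lra |].
      exists (Rmin (Rmin d1 d2) (t - t0)); split; [repeat apply Rmin_glb_lt; lra |].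
      intros r Hr; generalize (Rmin_l (Rmin d1 d2) (t - t0)) (Rmin_r (Rmin d1 d2) (t - t0))
        (Rmin_l d1 d2) (Rmin_r d1 d2); intros.
      specialize (H1 r ltac:(lra)); specialize (H2 r ltac:(lra)).
      apply Hbefore; lra. }
    assert (Hder_t : forall z z', z < h t -> z' < h t ->
              is_derive (fun r => w r z z') t (- 2 * ex t - (ut t z - ut t z'))).
    { intros z z' Hz Hz'; unfold w.
      assert (D1 := st_t _ _ _ _ _ _ _ _ Hu t z Hz).
      assert (D2 := st_t _ _ _ _ _ _ _ _ Hu t z' Hz').
      assert (D3 := Hdex t).
      auto_derive.
      - repeat split; first [eexists; exact D1 | eexists; exact D2 | eexists; exact D3].
      - subst_derive D1; subst_derive D2; subst_derive D3; ring. }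
    assert (Hnow : forall z z', h t - A < z < h t -> z - 1 <= z' <= z -> 0 <= w t z z').
    { intros z z' Hz Hz'; destruct (Hearlier z z' Hz Hz') as [d [Hd H]].
      apply (continuous_nonneg_left (fun r => w r z z') t d); [| exact Hd |].
      - apply (is_derive_continuous _ _ _ (Hder_t z z' ltac:(lra) ltac:(lra))).
      - intros r Hr; left; apply H, Hr. }
    assert (Hw0 : w t x y = 0) by (apply Rle_antisym; [exact Hwt | apply Hnow; lra]).
    assert (T1 : - 2 * ex t - (ut t x - ut t y) <= 0).
    { destruct (Hearlier x y ltac:(lra) ltac:(lra)) as [d [Hd H]].
      apply (left_derivative_nonpos (fun r => w r x y) t _ d);
        [apply is_derive_left, Hder_t; lra | exact Hd |].
      intros r Hr; rewrite Hw0; left; apply H, Hr. }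
    set (d := Rmin (Rmin (x - (h t - A)) (h t - x)) (Rmin (x - y) (y - (x - 1)))).
    assert (Hd : 0 < d /\ d <= x - (h t - A) /\ d <= h t - x /\ d <= x - y /\ d <= y - (x - 1)).
    { unfold d; generalize (Rmin_l (Rmin (x - (h t - A)) (h t - x)) (Rmin (x - y) (y - (x - 1))))
        (Rmin_r (Rmin (x - (h t - A)) (h t - x)) (Rmin (x - y) (y - (x - 1))))
        (Rmin_l (x - (h t - A)) (h t - x)) (Rmin_r (x - (h t - A)) (h t - x))
        (Rmin_l (x - y) (y - (x - 1))) (Rmin_r (x - y) (y - (x - 1))); intros.
      split; [repeat apply Rmin_glb_lt; lra | lra]. }
    assert (T2 : 0 <= - 2 * N - uxx t x).
    { apply (second_derivative_local_min (fun z => w t z y)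
               (fun z => N * (2 - 2 * (z - y)) - ux t z) x _ d); [lra | | |].
      - intros z Hz; apply Rabs_def2 in Hz; unfold w.
        assert (D1 := st_x _ _ _ _ _ _ _ _ Hu t z ltac:(lra)).
        auto_derive; [eexists; exact D1 | subst_derive D1; ring].
      - assert (D1 := st_xx _ _ _ _ _ _ _ _ Hu t x Hxh).
        auto_derive; [eexists; exact D1 | subst_derive D1; ring].
      - intros z Hz; rewrite Hw0; apply Rabs_def2 in Hz; apply Hnow; lra. }
    assert (T3 : 0 <= - 2 * N + uxx t y).
    { apply (second_derivative_local_min (fun z => w t x z)
               (fun z => - (N * (2 - 2 * (x - z))) + ux t z) y _ d); [lra | | |].
      - intros z Hz; apply Rabs_def2 in Hz; unfold w.
        assert (D1 := st_x _ _ _ _ _ _ _ _ Hu t z ltac:(lra)).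
        auto_derive; [eexists; exact D1 | subst_derive D1; ring].
      - assert (D1 := st_xx _ _ _ _ _ _ _ _ Hu t y ltac:(lra)).
        auto_derive; [eexists; exact D1 | subst_derive D1; ring].
      - intros z Hz; rewrite Hw0; apply Rabs_def2 in Hz; apply Hnow; lra. }
    rewrite (st_eq _ _ _ _ _ _ _ _ Hu t x Hxh), (st_eq _ _ _ _ _ _ _ _ Hu t y ltac:(lra)) in T1.
    assert (F1 := HFb (u t x) (conj (Hu0 t x ltac:(lra)) (Hu1 t x ltac:(lra)))).
    assert (F2 := HFb (u t y) (conj (Hu0 t y ltac:(lra)) (Hu1 t y ltac:(lra)))).
    apply Rabs_le_between in F1; apply Rabs_le_between in F2.
    specialize (Hex1 t ltac:(lra)); unfold N in *; lra. }
  unfold w in Hw; fold (ex t1) in HE.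
  assert (0 <= N * ((x1 - y1) * (x1 - y1))) by (apply Rmult_le_pos; [unfold N; lra | apply Rle_0_sqr]).
  lra.
Qed.

(** * Spreading of a gap below a shifted semi-wave *)

(** Criterion by the discriminant, for the bump below. *)
Lemma quadratic_pos : forall A B C m, 0 < B -> A * A < 4 * B * C -> 0 < C - A * m + B * (m * m).
Proof.
  intros A B C m HB H.
  assert (0 <= (2 * B * m - A) * (2 * B * m - A)) by apply Rle_0_sqr.
  assert (0 < 4 * B * (C - A * m + B * (m * m))) by lra.
  apply Rmult_lt_reg_l with (4 * B); lra.
Qed.

(** The barrier is Q(z - b + rho) with z = c t + xi - x and b a bump
    kap exp(-Lam (t - t1)) s^2 r^2, where s and r are the distances of z to the
    edges of an interval that starts inside the gap and grows in time. Perturbing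
    the argument of Q rather than its value leaves no term of order zero: with
    |Q''| <= C2 Q', the barrier is a supersolution as soon as
      b_zz - b_t - c b_z - 3 C2 |b_z| > 0,
    which holds near the edges since b_zz is positive there and elsewhere since
    Lam is large. At the front Z = 0 the boundary condition becomes
    b_t < c b_z (1 - b_z); it allows the edge of the bump to cross the front,
    because this edge moves in the z direction at speed c/2 only. At the edges
    b = 0, and the small constant rho makes the ordering strict there. *)
Lemma gap_spreads : forall f df mu c Q dQ ddQ u h ut ux uxx dh N xi L e,
  reaction f df -> 0 < mu -> profile f mu c Q dQ ddQ -> stefan f mu u h ut ux uxx dh ->
  0 < N ->
  (forall t x y, y <= x <= h t -> x - y <= 1 -> u t x - u t y <= N * (x - y)) ->
  (forall t x, x <= h t -> u t x <= Q (c * t + xi - x)) ->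
  0 < L -> 0 < e ->
  exists T rho, 0 < rho /\
    forall t1 x1, x1 <= h t1 -> c * t1 + xi - e - x1 < L ->
      u t1 x1 < Q (c * t1 + xi - e - x1) ->
      forall x, x <= h (t1 + T) -> c * (t1 + T) + xi - x < L ->
        u (t1 + T) x <= Q (c * (t1 + T) + xi - rho - x).
Proof.
  intros f df mu c Q dQ ddQ u h ut ux uxx dh N xi L e Hf Hmu HQ Hu HN Hlip Habove HL He.
  assert (Ho := pf_ode _ _ _ _ _ _ HQ).
  assert (Hmon := profile_le _ _ _ _ _ _ HQ). assert (Hlt := profile_lt _ _ _ _ _ _ HQ).
  assert (HQ0 := pf_zero _ _ _ _ _ _ HQ).
  assert (Hc := pf_speed _ _ _ _ _ _ HQ).
  assert (Hu0 := solution_nonneg _ _ _ _ _ _ _ _ Hu).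
  destruct (continuous_positive_below dQ 0 (L + e)) as [k [Hk HkQ]];
    [lra | apply Ho | apply HQ |].
  destruct (continuous_positive_below dQ 0 (2 * L + e + 3)) as [k2 [Hk2 Hk2Q]];
    [lra | apply Ho | apply HQ |].
  destruct (continuous_bounded f 0 1) as [F [HF HFb]]; [lra | |].
  { intros v _; apply (is_derive_continuous f v (df v)), Hf. }
  set (C2 := c + F / k2).
  assert (HFk : 0 < F / k2) by (apply Rdiv_lt_0_compat; lra).
  assert (HC2 : forall z, 0 < z <= 2 * L + e + 3 -> Rabs (ddQ z) <= C2 * dQ z).
  { intros z Hz; rewrite (po_eq _ _ _ _ _ Ho z (proj1 Hz)).
    assert (Hq : 0 <= Q z <= 1).
    { split; [rewrite <- HQ0; apply Hmon; lra | left; apply HQ]. }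
    specialize (HFb _ Hq); specialize (Hk2Q z ltac:(lra)).
    assert (HFq : F <= F / k2 * dQ z).
    { replace F with (F / k2 * k2) at 1 by (field; lra).
      apply Rmult_le_compat_l; lra. }
    assert (0 < c * dQ z) by (apply Rmult_lt_0_compat; [exact Hc | apply HQ]).
    apply Rabs_le_between in HFb; apply Rabs_le_between; unfold C2; lra. }
  (* by the Lipschitz bound the gap persists on an interval of length r0 *)
  set (r0 := Rmin 1 (Rmin (e / 4) (k * e / (2 * N)))).
  assert (Hr0 : 0 < r0 /\ r0 <= 1 /\ r0 <= e / 4 /\ N * r0 <= k * (e / 2)).
  { assert (H1 : 0 < k * e / (2 * N)) by (apply Rdiv_lt_0_compat; nra).
    unfold r0; generalize (Rmin_l 1 (Rmin (e / 4) (k * e / (2 * N))))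
      (Rmin_r 1 (Rmin (e / 4) (k * e / (2 * N))))
      (Rmin_l (e / 4) (k * e / (2 * N))) (Rmin_r (e / 4) (k * e / (2 * N))); intros.
    split; [repeat apply Rmin_glb_lt; lra |]; split; [lra |]; split; [lra |].
    replace (k * (e / 2)) with (N * (k * e / (2 * N))) by (field; lra).
    apply Rmult_le_compat_l; lra. }
  (* long enough for the edge moving at speed c/2 to pass from L + e to -1 *)
  set (T := 2 * (L + e + 2) / c).
  assert (HT : 0 < T) by (apply Rdiv_lt_0_compat; lra).
  assert (HcT : c / 2 * T = L + e + 2) by (unfold T; field; lra).
  set (S := (L + 2) / T).
  assert (HS : 0 < S) by (apply Rdiv_lt_0_compat; lra).
  assert (HST : S * T = L + 2) by (unfold S; field; lra).
  set (lm := r0 + (c / 2 + S) * T).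
  assert (Hlm : r0 < lm).
  { unfold lm; assert (0 < (c / 2 + S) * T) by (apply Rmult_lt_0_compat; lra); lra. }
  set (A0 := 12 + 2 * lm * (c / 2 + S) + (2 * c + 6 * C2) * lm).
  assert (HC20 : 0 < C2) by (unfold C2; lra).
  (* the first term controls the interior, the second one the free boundary *)
  set (Lam := A0 * A0 / (8 * (r0 * r0)) + 4 * (S + 5 / 4 * c) / e + 1).
  assert (Hsq : 0 <= A0 * A0 / (8 * (r0 * r0))).
  { apply Rmult_le_pos; [apply Rle_0_sqr | left; apply Rinv_0_lt_compat; nra]. }
  assert (HSe : 0 < 4 * (S + 5 / 4 * c) / e) by (apply Rdiv_lt_0_compat; lra).
  assert (HLam0 : 0 < Lam) by (unfold Lam; lra).
  assert (HLam1 : A0 * A0 < 4 * Lam * (2 * (r0 * r0))).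
  { assert (Hrr : 0 < r0 * r0) by (apply Rmult_lt_0_compat; lra).
    apply Rlt_le_trans with (A0 * A0 + 8 * (r0 * r0)); [lra |].
    replace (A0 * A0 + 8 * (r0 * r0))
      with (4 * (A0 * A0 / (8 * (r0 * r0)) + 1) * (2 * (r0 * r0))) by (field; lra).
    apply Rmult_le_compat_r; unfold Lam; lra. }
  assert (HLam2 : 2 * (S + 5 / 4 * c) <= Lam * (e / 2)).
  { replace (2 * (S + 5 / 4 * c)) with (4 * (S + 5 / 4 * c) / e * (e / 2)) by (field; lra).
    apply Rmult_le_compat_r; [lra | unfold Lam; lra]. }
  set (W := 1 + lm).
  assert (HW : 1 <= W) by (unfold W; lra).
  (* so small that b <= e/8 and |b_z| <= 1/4 *)
  set (kap := Rmin e 1 / (8 * (W * W * (W * W)))).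
  assert (HW4 : 0 < W * W * (W * W)) by (repeat apply Rmult_lt_0_compat; lra).
  assert (Hmin : 0 < Rmin e 1) by (apply Rmin_glb_lt; lra).
  assert (Hkap : 0 < kap) by (apply Rdiv_lt_0_compat; lra).
  assert (HkapW : kap * (W * W * (W * W)) = Rmin e 1 / 8) by (unfold kap; field; lra).
  set (rho := kap * exp (- Lam * T) / 2).
  assert (Hrho : 0 < rho).
  { unfold rho; assert (0 < kap * exp (- Lam * T)); [| lra].
    apply Rmult_lt_0_compat; [lra | apply exp_pos]. }
  assert (HexT : exp (- Lam * T) <= 1).
  { apply exp_le_1; assert (0 < Lam * T) by (apply Rmult_lt_0_compat; lra); lra. }
  assert (Hrho1 : rho <= 1 /\ rho <= e / 8).
  { assert (kap <= Rmin e 1 / 8).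
    { rewrite <- HkapW; rewrite <- (Rmult_1_r kap) at 1.
      apply Rmult_le_compat_l; [lra |].
      assert (1 <= W * W) by nra. nra. }
    assert (kap * exp (- Lam * T) <= kap * 1) by (apply Rmult_le_compat_l; lra).
    generalize (Rmin_l e 1) (Rmin_r e 1); unfold rho; lra. }
  exists T, rho; split; [exact Hrho |].
  intros t1 x1 Hx1 Hz1L Hgap x2 Hx2 Hz2.
  set (z1 := c * t1 + xi - x1).
  replace (c * t1 + xi - e - x1) with (z1 - e) in * by (unfold z1; ring).
  assert (Hz1e : 0 < z1 - e).
  { apply Rnot_le_lt; intros Hle; apply Hmon in Hle; rewrite HQ0 in Hle.
    specialize (Hu0 t1 x1 Hx1); lra. }
  (* distances, in the moving frame, to the two edges of the bump *)
  set (s := fun t x => c * t + xi - x - (z1 - r0 - c / 2 * (t - t1))).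
  set (r := fun t x => z1 + S * (t - t1) - (c * t + xi - x)).
  set (X := fun t => kap * exp (- Lam * (t - t1))).
  set (b := fun t x => X t * (s t x * s t x * (r t x * r t x))).
  set (Z := fun t x => c * t + xi - x - b t x + rho).
  set (bz := fun t x => X t * (2 * (s t x * r t x) * (r t x - s t x))).
  set (Zt := fun t x => c + Lam * b t x
               - X t * (2 * (s t x * r t x) * (3 / 2 * c * r t x + s t x * (S - c)))).
  set (Zx := fun t x => - (1 - bz t x)).
  set (Zxx := fun t x => - (X t * (2 * (s t x * s t x) - 8 * (s t x * r t x) + 2 * (r t x * r t x)))).
  assert (HX : forall t, t1 <= t -> 0 < X t <= kap).
  { intros t Ht; unfold X; assert (0 < exp (- Lam * (t - t1)) <= 1).
    { split; [apply exp_pos | apply exp_le_1].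
      assert (0 <= Lam * (t - t1)) by (apply Rmult_le_pos; lra); lra. }
    split; [apply Rmult_lt_0_compat; lra |].
    rewrite <- (Rmult_1_r kap) at 2; apply Rmult_le_compat_l; lra. }
  assert (Hsr : forall t x, t1 <= t <= t1 + T -> r0 <= s t x + r t x <= lm).
  { intros t x Ht; unfold s, r, lm.
    assert (0 <= (c / 2 + S) * (t - t1)) by (apply Rmult_le_pos; lra).
    assert ((c / 2 + S) * (t - t1) <= (c / 2 + S) * T) by (apply Rmult_le_compat_l; lra). lra. }
  assert (Hb : forall t x, t1 <= t <= t1 + T -> 0 <= s t x -> 0 <= r t x ->
            0 <= b t x <= e / 8 /\ Rabs (bz t x) <= 1 / 4).
  { intros t x Ht Hs Hr; specialize (Hsr t x Ht); specialize (HX t ltac:(lra)).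
    unfold b, bz; set (s' := s t x) in *; set (r' := r t x) in *; set (X' := X t) in *.
    assert (Hs' : s' <= W /\ r' <= W) by (unfold W; lra).
    assert (HssW : s' * s' <= W * W) by (apply Rmult_le_compat; lra).
    assert (HrrW : r' * r' <= W * W) by (apply Rmult_le_compat; lra).
    assert (HsrW : s' * r' <= W * W) by (apply Rmult_le_compat; lra).
    assert (Hs0 : 0 <= s' * s') by (apply Rmult_le_pos; lra).
    assert (Hr00 : 0 <= r' * r') by (apply Rmult_le_pos; lra).
    assert (Hsr0 : 0 <= s' * r') by (apply Rmult_le_pos; lra).
    assert (Hm : s' * s' * (r' * r') <= W * W * (W * W)) by (apply Rmult_le_compat; lra).
    assert (HXm : X' * (s' * s' * (r' * r')) <= kap * (W * W * (W * W))).
    { apply Rmult_le_compat; try lra; apply Rmult_le_pos; lra. }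
    split; [split |].
    - apply Rmult_le_pos; [lra | apply Rmult_le_pos; lra].
    - rewrite HkapW in HXm; generalize (Rmin_l e 1); lra.
    - rewrite !Rabs_mult, (Rabs_right X'), (Rabs_right 2), (Rabs_right s'), (Rabs_right r') by lra.
      assert (Hd : Rabs (r' - s') <= W) by (apply Rabs_le_between; lra).
      assert (HWW : W <= W * W) by nra.
      assert (Hm2 : s' * r' * Rabs (r' - s') <= W * W * (W * W)).
      { apply Rmult_le_compat; try lra; apply Rabs_pos. }
      assert (HXm2 : X' * (s' * r' * Rabs (r' - s')) <= kap * (W * W * (W * W))).
      { apply Rmult_le_compat; try lra; apply Rmult_le_pos; [lra | apply Rabs_pos]. }
      rewrite HkapW in HXm2; generalize (Rmin_r e 1); lra. }
  assert (Hbar := profile_barrier t1 f mu c Q dQ ddQ (fun _ => 1) (fun _ => 0) Z Zt Zx Zxx HQ).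
  match type of Hbar with _ -> _ -> _ -> _ -> _ -> _ -> ?goal => assert (HB : goal) end.
  { apply Hbar.
    - intros t _; lra.
    - intros t; apply (@is_derive_const R_AbsRing R_NormedModule).
    - intros tn xn t x Ht Hx.
      assert (Hct : is_cv (fun n => c * tn n + xi - xn n) (c * t + xi - x)).
      { apply is_cv_minus; [| exact Hx]; apply is_lim_seq_plus'; [| apply is_cv_const].
        apply is_cv_mult; [apply is_cv_const | exact Ht]. }
      assert (Htt : is_cv (fun n => tn n - t1) (t - t1)).
      { apply is_cv_minus; [exact Ht | apply is_cv_const]. }
      assert (Hscv : is_cv (fun n => s (tn n) (xn n)) (s t x)).
      { unfold s; apply is_cv_minus; [exact Hct |]; apply is_cv_minus; [apply is_cv_const |].
        apply is_cv_mult; [apply is_cv_const | exact Htt]. }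
      assert (Hrcv : is_cv (fun n => r (tn n) (xn n)) (r t x)).
      { unfold r; apply is_cv_minus; [| exact Hct]; apply is_lim_seq_plus'; [apply is_cv_const |].
        apply is_cv_mult; [apply is_cv_const | exact Htt]. }
      unfold Z; apply is_lim_seq_plus'; [| apply is_cv_const].
      apply is_cv_minus; [exact Hct |]; unfold b; apply is_cv_mult.
      + apply (is_cv_comp X); [| exact Ht].
        apply (ex_derive_continuous (K := R_AbsRing) (V := R_NormedModule)); unfold X.
        auto_derive; trivial.
      + apply is_cv_mult; apply is_cv_mult; assumption.
    - intros g t v Hg; unfold Z, Zt, Zx, bz, b, X, s, r.
      auto_derive; [repeat split; exists v; exact Hg |].
      subst_derive Hg; unfold Rminus; field.
    - intros t x; unfold Z, Zx, bz, b, X, s, r; auto_derive; [trivial |].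
      unfold Rminus; field.
    - intros t x; unfold Zx, Zxx, bz, X, s, r; auto_derive; [trivial |].
      unfold Rminus; field. }
  clear Hbar.
  set (lo := fun t => c * t + xi - (z1 + S * (t - t1))).
  set (hi := fun t => c * t + xi - (z1 - r0 - c / 2 * (t - t1))).
  assert (Hedge : forall t x, x <= h t -> s t x * r t x = 0 -> 0 < 1 * (1 * Q (Z t x) - u t x)).
  { intros t x Hx Hzero; specialize (Habove t x Hx).
    assert (Hb0 : b t x = 0).
    { unfold b; replace (s t x * s t x * (r t x * r t x)) with (s t x * r t x * (s t x * r t x)) by ring.
      rewrite Hzero; ring. }
    assert (Q (c * t + xi - x) < Q (Z t x)) by (apply Hlt; unfold Z; rewrite Hb0; lra). lra. }
  assert (Hcomp : forall t x, t1 <= t <= t1 + T -> lo t <= x <= hi t -> x <= h t ->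
            0 < 1 * (1 * Q (Z t x) - u t x)).
  { apply (barrier_comparison 1 f mu u h ut ux uxx dh _ _ _ _ lo hi t1 (t1 + T)
             (or_introl eq_refl) Hmu Hu HB).
    - intros t; unfold lo; apply (ex_derive_continuous (K := R_AbsRing) (V := R_NormedModule)).
      auto_derive; trivial.
    - intros t; unfold hi; apply (ex_derive_continuous (K := R_AbsRing) (V := R_NormedModule)).
      auto_derive; trivial.
    - intros t x Ht Hx Hxh HUu.
      assert (Hs0 : 0 < s t x) by (unfold hi, s in *; lra).
      assert (Hr00 : 0 < r t x) by (unfold lo, r in *; lra).
      destruct (Hb t x ltac:(lra) ltac:(lra) ltac:(lra)) as [Hb1 Hbz].
      assert (HZpos : 0 < Z t x).
      { apply Rnot_le_lt; intros Hle; apply Hmon in Hle; rewrite HQ0 in Hle.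
        generalize (st_pos _ _ _ _ _ _ _ _ Hu t x Hxh); lra. }
      assert (HZmax : Z t x <= 2 * L + e + 3).
      { assert (S * (t - t1) <= S * T) by (apply Rmult_le_compat_l; lra).
        unfold Z, r in *; lra. }
      assert (HdQ := pf_incr _ _ _ _ _ _ HQ (Z t x)).
      specialize (HC2 (Z t x) (conj HZpos HZmax)).
      assert (Hdd : f (1 * Q (Z t x)) = c * dQ (Z t x) - ddQ (Z t x)).
      { rewrite Rmult_1_l, (po_eq _ _ _ _ _ Ho _ HZpos); ring. }
      rewrite Hdd.
      specialize (Hsr t x ltac:(lra)); specialize (HX t ltac:(lra)).
      set (d1 := dQ (Z t x)) in *; set (d2 := ddQ (Z t x)) in *.
      set (m := s t x * r t x).
      assert (Hm : 0 < m) by (apply Rmult_lt_0_compat; assumption).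
      set (br := 2 * ((s t x + r t x) * (s t x + r t x)) - 12 * m
                 - 2 * m * (r t x * (c / 2) + s t x * S) + Lam * (m * m)
                 - c * (2 * m * (r t x - s t x))).
      replace (1 * (0 * Q (Z t x) + 1 * (d1 * Zt t x) -
                 1 * (d2 * (Zx t x * Zx t x) + d1 * Zxx t x) - (c * d1 - d2)))
        with (d1 * (X t * br) + d2 * (bz t x * (2 - bz t x)))
        by (unfold Zt, Zx, Zxx, b, br, bz, m; field).
      assert (Habs : Rabs (bz t x) <= X t * (2 * m * lm)).
      { unfold bz; fold m; rewrite Rabs_mult, (Rabs_right (X t)) by lra.
        apply Rmult_le_compat_l; [lra |].
        rewrite Rabs_mult, (Rabs_right (2 * m)) by lra.
        apply Rmult_le_compat_l; [lra |]; apply Rabs_le_between; lra. }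
      assert (Hsec : - (C2 * d1 * (3 * (X t * (2 * m * lm)))) <= d2 * (bz t x * (2 - bz t x))).
      { assert (Hr3 : Rabs (d2 * (bz t x * (2 - bz t x))) <= C2 * d1 * (3 * (X t * (2 * m * lm)))).
        { rewrite Rabs_mult; apply Rmult_le_compat; [apply Rabs_pos | apply Rabs_pos | exact HC2 |].
          rewrite Rabs_mult, Rmult_comm.
          apply Rmult_le_compat; [apply Rabs_pos | apply Rabs_pos | | exact Habs].
          apply Rabs_le_between in Hbz; apply Rabs_le_between; lra. }
        apply Rabs_le_between in Hr3; lra. }
      assert (Hbr : 0 < br - 6 * C2 * m * lm).
      { assert (Hq := quadratic_pos A0 Lam (2 * (r0 * r0)) m HLam0 HLam1).
        assert (Hrr : r0 * r0 <= (s t x + r t x) * (s t x + r t x)) by (apply Rmult_le_compat; lra).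
        assert (Hsp : r t x * (c / 2) + s t x * S <= lm * (c / 2 + S)).
        { assert ((s t x + r t x) * (c / 2 + S) <= lm * (c / 2 + S)) by (apply Rmult_le_compat_r; lra).
          assert (0 < s t x * c) by (apply Rmult_lt_0_compat; lra).
          assert (0 < r t x * S) by (apply Rmult_lt_0_compat; lra). lra. }
        assert (Hsp2 : m * (r t x * (c / 2) + s t x * S) <= m * (lm * (c / 2 + S)))
          by (apply Rmult_le_compat_l; lra).
        assert (Hcd : c * (2 * m * (r t x - s t x)) <= c * (2 * m * lm)).
        { apply Rmult_le_compat_l; [lra |]; apply Rmult_le_compat_l; lra. }
        unfold br, A0 in *; lra. }
      assert (0 < d1 * (X t * (br - 6 * C2 * m * lm))).
      { apply Rmult_lt_0_compat; [exact HdQ | apply Rmult_lt_0_compat; lra]. }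
      lra.
    - intros t x Ht Hx Hxh HU0.
      assert (Hs0 : 0 < s t x) by (unfold hi, s in *; lra).
      assert (Hr00 : 0 < r t x) by (unfold lo, r in *; lra).
      destruct (Hb t x ltac:(lra) ltac:(lra) ltac:(lra)) as [Hb1 Hbz].
      specialize (HX t ltac:(lra)).
      assert (HZ0 : Z t x = 0).
      { rewrite Rmult_1_l, <- HQ0 in HU0.
        destruct (Rtotal_order (Z t x) 0) as [Hl | [H | Hl]]; [| exact H |];
          apply Hlt in Hl; lra. }
      assert (Hre : e / 2 <= r t x).
      { assert (0 <= S * (t - t1)) by (apply Rmult_le_pos; lra).
        unfold Z in HZ0; unfold r; lra. }
      rewrite HZ0; assert (HdQ := pf_incr _ _ _ _ _ _ HQ 0).
      assert (Hsl := pf_slope _ _ _ _ _ _ HQ).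
      apply Rabs_le_between in Hbz.
      unfold Zx; split; [assert (0 < dQ 0 * (1 - bz t x)) by (apply Rmult_lt_0_compat; lra); lra |].
      set (m := s t x * r t x).
      assert (Hm : 0 < m) by (apply Rmult_lt_0_compat; assumption).
      set (br := c * ((r t x - s t x) * (1 - bz t x)) - r t x * (c / 2) - s t x * S + Lam * m / 2).
      replace (1 * (0 * Q 0 + 1 * (dQ 0 * Zt t x) -
                 mu * (1 * (dQ 0 * - (1 - bz t x)) * (1 * (dQ 0 * - (1 - bz t x))))))
        with (dQ 0 * (Zt t x - mu * dQ 0 * ((1 - bz t x) * (1 - bz t x)))) by ring.
      rewrite <- Hsl.
      replace (Zt t x - c * ((1 - bz t x) * (1 - bz t x)))
        with (X t * (2 * m * br)) by (unfold Zt, b, br, bz, m; field).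
      assert (Hbr : 0 < br).
      { assert (B1 : 3 / 4 * r t x - 5 / 4 * s t x <= (r t x - s t x) * (1 - bz t x)) by nra.
        assert (B2 : c * (3 / 4 * r t x - 5 / 4 * s t x) <= c * ((r t x - s t x) * (1 - bz t x)))
          by (apply Rmult_le_compat_l; lra).
        assert (B3 : Lam * (e / 2) <= Lam * r t x) by (apply Rmult_le_compat_l; lra).
        assert (B4 : s t x * (2 * (S + 5 / 4 * c)) <= s t x * (Lam * r t x))
          by (apply Rmult_le_compat_l; lra).
        assert (B5 : 0 < c * r t x) by (apply Rmult_lt_0_compat; lra).
        unfold br, m; lra. }
      assert (0 < 2 * m * br) by (apply Rmult_lt_0_compat; lra).
      apply Rmult_lt_0_compat; [lra | apply Rmult_lt_0_compat; lra].
    - intros x Hx Hxh.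
      assert (Hs0 : 0 <= s t1 x) by (unfold hi, s in *; lra).
      assert (Hr00 : 0 <= r t1 x) by (unfold lo, r in *; lra).
      destruct (Hb t1 x ltac:(lra) Hs0 Hr00) as [Hb1 _].
      assert (Hxx : 0 <= x - x1 <= r0) by (unfold s, r, z1 in *; lra).
      assert (Hl := Hlip t1 x x1 ltac:(lra) ltac:(lra)).
      assert (HN0 : N * (x - x1) <= N * r0) by (apply Rmult_le_compat_l; lra).
      destruct (mean_value Q dQ (z1 - e) (z1 - e + e / 2)) as [w [Hw Hw']];
        [lra | intros; apply Ho | intros; apply (po_Q_cont _ _ _ _ _ Ho) |].
      assert (Hkw : k <= dQ w) by (apply HkQ; lra).
      assert (k * (e / 2) <= dQ w * (e / 2)) by (apply Rmult_le_compat_r; lra).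
      assert (HQQ : Q (z1 - e + e / 2) <= Q (Z t1 x)).
      { apply Hmon; unfold Z, s in *; lra. }
      lra.
    - intros t Ht Hle; apply Hedge; [exact Hle |]; unfold lo, r; ring.
    - intros t Ht Hle; apply Hedge; [exact Hle |]; unfold hi, s; ring. }
  assert (Hz0 : 0 <= c * (t1 + T) + xi - x2).
  { apply Rnot_lt_le; intros Hl; apply Hlt in Hl; rewrite HQ0 in Hl.
    specialize (Habove _ _ Hx2); specialize (Hu0 _ _ Hx2); lra. }
  assert (Hs1 : 1 <= s (t1 + T) x2) by (unfold s; lra).
  assert (Hr1 : 1 <= r (t1 + T) x2) by (unfold r; lra).
  assert (H := Hcomp (t1 + T) x2 ltac:(lra) ltac:(unfold lo, hi, s, r in *; lra) Hx2).
  assert (Hbig : 2 * rho <= b (t1 + T) x2).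
  { unfold b, X, rho; replace (t1 + T - t1) with T by ring.
    set (q := s (t1 + T) x2) in *; set (p := r (t1 + T) x2) in *.
    assert (1 * 1 <= q * q) by (apply Rmult_le_compat; lra).
    assert (1 * 1 <= p * p) by (apply Rmult_le_compat; lra).
    assert (1 * 1 <= q * q * (p * p)) by (apply Rmult_le_compat; lra).
    replace (2 * (kap * exp (- Lam * T) / 2)) with (kap * exp (- Lam * T) * 1) by field.
    apply Rmult_le_compat_l; [| lra].
    left; apply Rmult_lt_0_compat; [lra | apply exp_pos]. }
  assert (Q (Z (t1 + T) x2) <= Q (c * (t1 + T) + xi - rho - x2)) by (apply Hmon; unfold Z; lra).
  lra.
Qed.

(** * Sliding *)

(** The sign e has the same meaning as in [stable_semi_wave]. *)
Definition ordered_shift (c : R) (Q : R -> R) (u : R -> R -> R) (h : R -> R) (e xi : R) : Prop :=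
  forall t x, x <= h t -> 0 <= e * (Q (c * t + xi - x) - u t x).

Lemma optimal_shift : forall f mu c Q dQ ddQ u h e,
  profile f mu c Q dQ ddQ -> (forall t, u t (h t) = 0) ->
  e = 1 \/ e = -1 -> (exists xi, ordered_shift c Q u h e xi) ->
  exists xi, ordered_shift c Q u h e xi /\ e * h 0 <= e * xi /\
    forall xi', ordered_shift c Q u h e xi' -> e * xi <= e * xi'.
Proof.
  intros f mu c Q dQ ddQ u h e HQ Hz He [xi0 H0].
  assert (Ho := pf_ode _ _ _ _ _ _ HQ).
  assert (Hlt := profile_lt _ _ _ _ _ _ HQ). assert (HQ0 := pf_zero _ _ _ _ _ _ HQ).
  assert (Hlow : forall xi, ordered_shift c Q u h e xi -> e * h 0 <= e * xi).
  { intros xi H; specialize (H 0 (h 0) (Rle_refl _)).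
    rewrite Hz, Rminus_0_r in H; apply Rnot_lt_le; intros Hl.
    destruct He as [-> | ->].
    - assert (H1 := Hlt (c * 0 + xi - h 0) 0 ltac:(lra)); lra.
    - assert (H1 := Hlt 0 (c * 0 + xi - h 0) ltac:(lra)); lra. }
  destruct (completeness (fun y => ordered_shift c Q u h e (e * - y))) as [m [Hm1 Hm2]].
  - exists (- (e * h 0)); intros y Hy; apply Hlow in Hy.
    destruct He as [-> | ->]; lra.
  - exists (- (e * xi0)).
    replace (e * - - (e * xi0)) with xi0 by (destruct He as [-> | ->]; ring); exact H0.
  - exists (e * - m).
    assert (Hopt : ordered_shift c Q u h e (e * - m)).
    { intros t x Hx.
      set (g := fun r => e * (Q (c * t + e * - m + e * (- r) - x) - u t x)).
      assert (Hg : 0 <= g 0).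
      { apply (continuous_nonneg_left g 0 1); [| lra |].
        - apply (ex_derive_continuous (K := R_AbsRing) (V := R_NormedModule)); unfold g.
          auto_derive; eexists; apply Ho.
        - intros r Hr; apply Rnot_lt_le; intros Hneg.
          (* otherwise m + r would bound the admissible shifts *)
          assert (m <= m + r); [| lra].
          apply Hm2; intros y Hy; apply Rnot_lt_le; intros Hyr.
          specialize (Hy t x Hx); unfold g in Hneg.
          destruct He as [-> | ->].
          + assert (H1 := Hlt (c * t + 1 * - y - x) (c * t + 1 * - m + 1 * - r - x) ltac:(lra)); lra.
          + assert (H1 := Hlt (c * t + -1 * - m + -1 * - r - x) (c * t + -1 * - y - x) ltac:(lra)); lra. }
      unfold g in Hg; rewrite Ropp_0, Rmult_0_r, Rplus_0_r in Hg; exact Hg. }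
    split; [exact Hopt | split; [apply Hlow, Hopt |]].
    intros xi' H'.
    assert (- (e * xi') <= m).
    { apply Hm1; replace (e * - - (e * xi')) with xi' by (destruct He as [-> | ->]; ring); exact H'. }
    destruct He as [-> | ->]; lra.
Qed.

(** Far from the front a small shift is a relative perturbation of much smaller
    size, because Q' tends to 0. *)
Lemma profile_flat_shift : forall f mu c Q dQ ddQ eps,
  profile f mu c Q dQ ddQ -> 0 < eps ->
  exists L, 0 < L /\ forall z rho, L <= z -> 0 < rho <= 1 ->
    Q z <= (1 + 2 * rho * eps) * Q (z - rho) /\
    (1 - 2 * rho * eps) * Q z <= Q (z - rho).
Proof.
  intros f mu c Q dQ ddQ eps HQ Heps.
  assert (Ho := pf_ode _ _ _ _ _ _ HQ).
  destruct (pf_flat _ _ _ _ _ _ HQ eps Heps) as [Z1 H1].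
  destruct (pf_lim _ _ _ _ _ _ HQ (1 / 2)) as [Z2 H2]; [lra |].
  set (L := Rmax (Rmax Z1 Z2) 0 + 2).
  assert (HL : Z1 < L - 1 /\ Z2 < L - 1 /\ 0 < L - 1).
  { unfold L; generalize (Rmax_l (Rmax Z1 Z2) 0) (Rmax_r (Rmax Z1 Z2) 0) (Rmax_l Z1 Z2)
      (Rmax_r Z1 Z2); lra. }
  exists L; split; [lra |]; intros z rho Hz Hrho.
  destruct (mean_value Q dQ (z - rho) z) as [w [Hw Hw']];
    [lra | intros; apply Ho | intros; apply (po_Q_cont _ _ _ _ _ Ho) |].
  assert (A1 := H1 w ltac:(lra)).
  assert (A2 := H2 z ltac:(lra)); assert (A3 := H2 (z - rho) ltac:(lra)).
  assert (A4 : Q z - Q (z - rho) <= eps * rho).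
  { rewrite Hw'; replace (z - (z - rho)) with rho by ring; apply Rmult_le_compat_r; lra. }
  assert (A5 : 0 < rho * eps) by (apply Rmult_lt_0_compat; lra).
  assert (rho * eps * (1 / 2) <= rho * eps * Q (z - rho)) by (apply Rmult_le_compat_l; lra).
  assert (rho * eps * (1 / 2) <= rho * eps * Q z) by (apply Rmult_le_compat_l; lra).
  lra.
Qed.

(** With one length L serving both improvements: behind the distance L a shift
    by rho costs a relative error 2 rho eps only, which stability converts into
    a shift of rho / 2, whatever the size of rho. *)
Lemma semi_wave_rigidity : forall f df mu c Q dQ ddQ u h ut ux uxx dh M,
  reaction f df -> 0 < mu -> profile f mu c Q dQ ddQ ->
  stefan f mu u h ut ux uxx dh -> tends_to_one u h ->
  0 < M -> (forall t x, x <= h t -> u t x <= M) ->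
  (forall t x, x <= h t -> u t x = Q (h t - x)) /\ (forall t, h t = c * t + h 0).
Proof.
  intros f df mu c Q dQ ddQ u h ut ux uxx dh M Hf Hmu HQ Hu Hfar HM HuM.
  assert (Hu1 := solution_le_1 _ _ _ _ _ _ _ _ _ _ Hf Hmu Hu Hfar HM HuM).
  assert (Hu0 := solution_nonneg _ _ _ _ _ _ _ _ Hu).
  assert (Hmon := profile_le _ _ _ _ _ _ HQ). assert (Hlt := profile_lt _ _ _ _ _ _ HQ).
  assert (HQ0 := pf_zero _ _ _ _ _ _ HQ).
  destruct (semi_wave_stability _ _ _ _ _ _ _ _ _ _ _ _ _ Hf Hmu HQ Hu Hfar Hu1)
    as [p0 [beta [sigma [Hp0 [Hbeta [Hsigma Hst]]]]]].
  assert (Hex := solution_between_shifts _ _ _ _ _ _ _ _ _ _ _ _ _ _ _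
                   HQ Hu Hfar Hu1 Hp0 Hbeta Hsigma Hst).
  destruct (optimal_shift _ _ _ _ _ _ u h 1 HQ (st_zero _ _ _ _ _ _ _ _ Hu)
              (or_introl eq_refl) (Hex 1 (or_introl eq_refl))) as [xp [Hxp [Hxp0 Hxpmin]]].
  destruct (optimal_shift _ _ _ _ _ _ u h (-1) HQ (st_zero _ _ _ _ _ _ _ _ Hu)
              (or_intror eq_refl) (Hex (-1) (or_intror eq_refl))) as [xm [Hxm [Hxm0 Hxmmax]]].
  assert (Hmove := fun e p xi He Hp Hord =>
    entire_ordering f mu c Q dQ ddQ u h p0 beta sigma e p xi HQ Hbeta Hst He Hp Hord).
  assert (Heq : xm = xp).
  { destruct (Rle_lt_dec xp xm) as [Hle | Hgap]; [lra | exfalso].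
    set (eps := 1 / (4 * sigma)).
    assert (Heps : 0 < eps) by (apply Rdiv_lt_0_compat; lra).
    assert (Hse : sigma * eps = 1 / 4) by (unfold eps; field; lra).
    destruct (profile_flat_shift _ _ _ _ _ _ eps HQ Heps) as [L [HL Hflat]].
    set (cap := Rmin 1 (p0 / (2 * eps))).
    assert (Hcap : 0 < cap).
    { apply Rmin_glb_lt; [lra | apply Rdiv_lt_0_compat; lra]. }
    (* cap keeps the relative error in the range of the stability lemma; by the
       choice of eps it costs half of the shift rho *)
    assert (Hp : forall rho, 0 < rho <= cap ->
              rho <= 1 /\ 0 < 2 * rho * eps <= p0 /\ sigma * (2 * rho * eps) = rho / 2).
    { intros rho Hrho; generalize (Rmin_l 1 (p0 / (2 * eps))) (Rmin_r 1 (p0 / (2 * eps))).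
      fold cap; intros C1 C2; split; [lra |]; split; [split |].
      - apply Rmult_lt_0_compat; lra.
      - replace p0 with (2 * (p0 / (2 * eps)) * eps) by (field; lra).
        apply Rmult_le_compat_r; lra.
      - replace (sigma * (2 * rho * eps)) with (2 * rho * (sigma * eps)) by ring.
        rewrite Hse; field. }
    set (rho0 := Rmin ((xp - xm) / 2) cap).
    assert (Hrho0 : 0 < rho0 <= cap /\ rho0 <= (xp - xm) / 2).
    { unfold rho0; generalize (Rmin_l ((xp - xm) / 2) cap) (Rmin_r ((xp - xm) / 2) cap).
      intros; split; [split; [apply Rmin_glb_lt; lra | lra] | lra]. }
    assert (Hgaps : forall T, exists t1 x1, t1 <= T /\ x1 <= h t1 /\
              c * t1 + xm + rho0 - x1 < L /\ u t1 x1 < Q (c * t1 + xm + rho0 - x1)).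
    { intros T; apply NNPP; intros Hno.
      destruct (Hp rho0 (proj1 Hrho0)) as [P1 [P2 P3]].
      assert (Hbetter : ordered_shift c Q u h (-1)
                          (xm + rho0 + -1 * (sigma * (2 * rho0 * eps)))).
      { intros t x Hx; rewrite <- Rplus_assoc.
        apply (Hmove (-1) (2 * rho0 * eps) (xm + rho0) (or_intror eq_refl) P2); [| exact Hx].
        intros T'; exists (Rmin T T'); split; [apply Rmin_r |].
        assert (HTT := Rmin_l T T'); set (t0 := Rmin T T') in *; clearbody t0.
        intros y Hy; rewrite <- Rplus_assoc.
        assert (Hy0 := Hu0 t0 y Hy).
        destruct (Rlt_le_dec (c * t0 + xm + rho0 - y) L) as [Hz | Hz].
        - assert (Hq : Q (c * t0 + xm + rho0 - y) <= u t0 y).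
          { apply Rnot_lt_le; intros Hl; apply Hno; exists t0, y; auto. }
          assert (0 < 1 + -1 * (2 * rho0 * eps)) by lra.
          destruct (Rle_lt_dec (Q (c * t0 + xm + rho0 - y)) 0); nra.
        - destruct (Hflat _ rho0 Hz ltac:(lra)) as [_ Hfl].
          specialize (Hxm t0 y Hy).
          replace (c * t0 + xm + rho0 - y - rho0) with (c * t0 + xm - y) in Hfl by ring. lra. }
      apply Hxmmax in Hbetter; lra. }
    assert (Habove : forall t x, x <= h t -> u t x <= Q (c * t + xp - x)).
    { intros t x Hx; specialize (Hxp t x Hx); lra. }
    destruct (solution_one_sided_lipschitz _ _ _ _ _ _ _ _ _ Hf Hu Hfar Hu1) as [N [HN Hlip]].
    destruct (gap_spreads f df mu c Q dQ ddQ u h ut ux uxx dh N xp L (xp - xm - rho0)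
                Hf Hmu HQ Hu HN Hlip Habove HL ltac:(lra)) as [T [rho [Hrho Hspread]]].
    set (rho1 := Rmin rho cap).
    assert (Hrho1 : 0 < rho1 <= cap /\ rho1 <= rho).
    { unfold rho1; generalize (Rmin_l rho cap) (Rmin_r rho cap).
      intros; split; [split; [apply Rmin_glb_lt; lra | lra] | lra]. }
    destruct (Hp rho1 (proj1 Hrho1)) as [P1 [P2 P3]].
    assert (Hbetter : ordered_shift c Q u h 1 (xp - rho1 + 1 * (sigma * (2 * rho1 * eps)))).
    { intros t x Hx; rewrite <- Rplus_assoc.
      apply (Hmove 1 (2 * rho1 * eps) (xp - rho1) (or_introl eq_refl) P2); [| exact Hx].
      intros T'; destruct (Hgaps (T' - T)) as [t1 [x1 [Ht1 [Hx1 [Hz1 Hg1]]]]].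
      exists (t1 + T); split; [lra |]; intros y Hy.
      replace (c * t1 + xm + rho0 - x1) with (c * t1 + xp - (xp - xm - rho0) - x1) in Hz1, Hg1 by ring.
      assert (Hy0 := Hu0 _ y Hy).
      replace (c * (t1 + T) + (xp - rho1) - y) with (c * (t1 + T) + xp - y - rho1) by ring.
      destruct (Rlt_le_dec (c * (t1 + T) + xp - y) L) as [Hz | Hz].
      - assert (Hs := Hspread t1 x1 Hx1 Hz1 Hg1 y Hy Hz).
        assert (Hm := Hmon (c * (t1 + T) + xp - rho - y) (c * (t1 + T) + xp - y - rho1) ltac:(lra)).
        assert (0 <= 2 * rho1 * eps * Q (c * (t1 + T) + xp - y - rho1))
          by (apply Rmult_le_pos; lra).
        lra.
      - destruct (Hflat _ rho1 Hz ltac:(lra)) as [Hfl _].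
        specialize (Habove _ y Hy); lra. }
    apply Hxpmin in Hbetter; lra. }
  subst xm.
  assert (Hall : forall t x, x <= h t -> u t x = Q (c * t + xp - x)).
  { intros t x Hx; specialize (Hxp t x Hx); specialize (Hxm t x Hx); lra. }
  assert (Hfront : forall t, h t = c * t + xp).
  { intros t; assert (H := Hall t (h t) (Rle_refl _)).
    rewrite (st_zero _ _ _ _ _ _ _ _ Hu), <- HQ0 in H.
    destruct (Rtotal_order 0 (c * t + xp - h t)) as [Hl | [Hl | Hl]];
      [apply Hlt in Hl; lra | lra | apply Hlt in Hl; lra]. }
  split.
  - intros t x Hx; rewrite (Hall t x Hx), (Hfront t); reflexivity.
  - intros t; rewrite (Hfront t), (Hfront 0); ring.
Qed.

(** * From the half-line formulation *)

Lemma continuous_on_closed_cv : forall u h,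
  continuous_on (Omega_closed h) (uncurry2 u) -> (forall t, continuous h t) ->
  forall tn xn t x, (forall n, xn n <= h (tn n)) -> is_cv tn t -> is_cv xn x ->
    is_cv (fun n => u (tn n) (xn n)) (u t x).
Proof.
  intros u h Hc Hh tn xn t x Hn Ht Hx.
  assert (Hxh : Omega_closed h (t, x)).
  { apply (is_cv_le xn (fun n => h (tn n))); [exact Hn | exact Hx | apply is_cv_comp; auto]. }
  apply is_cv_eps; intros eps He.
  destruct (proj1 (filterlim_locally _ _) (Hc _ Hxh) (mkposreal eps He)) as [d Hd].
  destruct (proj1 (is_cv_eps tn t) Ht d (cond_pos d)) as [N1 H1].
  destruct (proj1 (is_cv_eps xn x) Hx d (cond_pos d)) as [N2 H2].
  exists (max N1 N2); intros n Hmax.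
  apply (Hd (tn n, xn n)); [split | apply Hn].
  - apply H1, Nat.le_trans with (2 := Hmax), Nat.le_max_l.
  - apply H2, Nat.le_trans with (2 := Hmax), Nat.le_max_r.
Qed.

Theorem theorem2p1 :
  forall (mu : R) (f df : R -> R),
    0 < mu ->
    C1_nonneg f df ->
    f 0 = 0 -> f 1 = 0 ->
    df 1 < 0 ->
    (forall v, 1 < v -> f v < 0) ->
  forall (cstar : R) (qstar : R -> R),
    semi_wave_profile f mu cstar qstar ->
  forall (u : R -> R -> R) (h : R -> R),
    transition_semi_wave f mu u h ->
    bounded_in h u ->
    (forall t x, x <= h t -> u t x = qstar (h t - x)) /\
    (forall t, h t = cstar * t + h 0).
Proof.
  intros mu f df Hmu Hf Hf0 Hf1 Hdf1 Hfneg c q Hq u h [Hent [Hpos Hone]] [M HM].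
  destruct (C1_extension f df Hf) as [F [dF [HF1 [HF2 [HF3 [HF4 _]]]]]].
  assert (HF : reaction F dF).
  { constructor; try assumption; try (rewrite HF3; lra); try (rewrite HF4; lra).
    intros v Hv; rewrite HF3 by lra; apply Hfneg, Hv. }
  destruct Hq as [dq [ddq [Hq1 [Hdq1 [Hode [Hqpos [Hq0 [Hqlim Hqb]]]]]]]].
  destruct (C1_extension q dq Hq1) as [Q [dQ [HQ1 [HQ2 [HQ3 [HQ4 HQ5]]]]]].
  assert (HQ : profile F mu c Q dQ ddq).
  { apply (profile_of_semi_wave F dF); auto.
    - constructor; auto.
      + intros z Hz; apply (is_derive_ext_near dq dQ z _ z Hz).
        * intros y Hy; apply Rabs_def2 in Hy; rewrite HQ4; [reflexivity | lra].
        * apply (D_in_interior dq ddq Defs.nonneg z z); [apply Hdq1; lra | exact Hz |].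
          intros y Hy; apply Rabs_def2 in Hy; unfold Defs.nonneg; lra.
      + intros z Hz; rewrite HQ3, HQ4 by lra.
        rewrite HF3 by (left; apply Hqpos, Hz); specialize (Hode z Hz); lra.
    - intros z Hz; rewrite (HQ5 z Hz), (HQ4 0 (Rle_refl 0)); reflexivity.
    - rewrite HQ3; [exact Hq0 | lra].
    - intros z Hz; rewrite HQ3 by lra; apply Hqpos, Hz.
    - apply (is_lim_ext_loc q); [| exact Hqlim].
      exists 0; intros z Hz; symmetry; apply HQ3; lra.
    - rewrite (HQ4 0 (Rle_refl 0)); exact Hqb. }
  destruct Hent as [ut [ux [uxx [dh [E1 [_ [E3 [E4 [E5 [E6 [_ [_ [_ [E10 [E11 E12]]]]]]]]]]]]]]].
  assert (Hu : stefan F mu u h ut ux uxx dh).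
  { constructor; auto.
    - intros t x Hx; apply (D_in_interior (u t) (ux t) (fun y => y <= h t) x (h t - x));
        [apply E4; lra | lra |].
      intros y Hy; apply Rabs_def2 in Hy; lra.
    - intros t eps He.
      destruct (D_in_eps _ _ _ _ (E4 t (h t) (Rle_refl _)) eps He) as [d [Hd H]].
      exists d; split; [exact Hd |]; intros y Hy; apply H; [lra | lra |].
      rewrite Rabs_left; lra.
    - apply continuous_on_closed_cv; [exact E6 |].
      intros t; apply (is_derive_continuous h t (dh t)), E1.
    - intros t x Hx; rewrite HF3 by (left; apply Hpos, Hx); apply E10, Hx. }
  assert (Hfar : tends_to_one u h).
  { intros eps He; destruct (Hone eps He) as [A HA].
    exists (Rabs A + 1); split; [generalize (Rabs_pos A); lra |]; intros t x Hx.
    replace (u t x) with (u t (x - h t + h t)) by (f_equal; ring).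
    apply HA; generalize (Rle_abs (- A)); rewrite Rabs_Ropp; lra. }
  destruct (semi_wave_rigidity F dF mu c Q dQ ddq u h ut ux uxx dh (Rabs M + 1) HF Hmu HQ Hu Hfar)
    as [R1 R2].
  - generalize (Rabs_pos M); lra.
  - intros t x [Hx | ->].
    + generalize (Rle_abs M) (HM t x Hx) (Rle_abs (u t x)); lra.
    + rewrite E11; generalize (Rabs_pos M); lra.
  - split; [| exact R2].
    intros t x Hx; rewrite (R1 t x Hx); apply HQ3; lra.
Qed.
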